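(* Let $\mathcal{A}$ be a unital $C^{*}$-algebra, let $F,D\in B^{a}(H_{\mathcal{A}})$ and suppose that $\operatorname{Im}F$, $\operatorname{Im}D$, $\operatorname{Im}DF$ are closed. Then $$(\operatorname{Im}DF)^{\perp}\preceq(\operatorname{Im}F)^{\perp}\oplus(\operatorname{Im}D)^{\perp},\qquad \ker DF\preceq\ker D\oplus\ker F.$$
   Context: $H_{\mathcal{A}}=l_2(\mathcal{A})$ is the standard (right) Hilbert $C^{*}$-module over $\mathcal{A}$ of sequences $(a_i)_{i\in\mathbb{N}}$ in $\mathcal{A}$ with $\sum_i a_i^{*}a_i$ norm-convergent, and $B^{a}(H_{\mathcal{A}})$ is the set of bounded adjointable operators on it. $N_1\preceq N_2$ means that $N_1$ is isomorphic (via a bounded $\mathcal{A}$-linear bijection) to a closed submodule of $N_2$; $\oplus$ in the displayed relations is the (external) direct sum of Hilbert modules. *)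

(* Defs.v *)
From HB Require Import structures.
From mathcomp Require Import all_boot all_order all_algebra.
From mathcomp Require Import complex.
From mathcomp Require Import all_classical all_reals all_analysis.

Set Implicit Arguments.
Unset Strict Implicit.
Unset Printing Implicit Defensive.

Import Order.TTheory GRing.Theory Num.Theory numFieldNormedType.Exports.
Local Open Scope classical_set_scope.
Local Open Scope complex_scope.
Local Open Scope ring_scope.

(* Unital C*-algebras: complex Banach *-algebras with the C*-identity. Norms
   take values in the nonnegative reals of R[i]. The multiplication is part of
   the mixin because a structure joining the library's rings and normed modules
   would conflict with numDomainType; the ring structure is recovered as an
   instance below. It is a pzRingType rather than an algType (which imposes
   1 != 0), so the zero algebra is allowed. *)
HB.mixin Record isCStarAlgebra (R : realType) A
    of CompleteNormedModule R[i] A := {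
  cstar_one : A ;
  cstar_mul : A -> A -> A ;
  cstar_mulA : associative cstar_mul ;
  cstar_mul1r : left_id cstar_one cstar_mul ;
  cstar_mulr1 : right_id cstar_one cstar_mul ;
  cstar_mulDl : left_distributive cstar_mul +%R ;
  cstar_mulDr : right_distributive cstar_mul +%R ;
  cstar_scalerAl : forall (l : R[i]) (a b : A),
    l *: cstar_mul a b = cstar_mul (l *: a) b ;
  cstar_scalerAr : forall (l : R[i]) (a b : A),
    l *: cstar_mul a b = cstar_mul a (l *: b) ;
  cstar_normM : forall a b : A, `|cstar_mul a b| <= `|a| * `|b| ;
  star : A -> A ;
  starK : involutive star ;
  starD : {morph star : a b / a + b} ;
  starZ : forall (l : R[i]) (a : A), star (l *: a) = Num.conj l *: star a ;
  starM : forall a b : A, star (cstar_mul a b) = cstar_mul (star b) (star a) ;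
  cstar_norm : forall a : A, `|cstar_mul (star a) a| = `|a| ^+ 2
}.

#[short(type="cstarAlgType")]
HB.structure Definition CStarAlgebra (R : realType) :=
  {A of isCStarAlgebra R A & CompleteNormedModule R[i] A}.

HB.instance Definition _ (R : realType) (A : cstarAlgType R) :=
  GRing.Zmodule_isPzRing.Build A (@cstar_mulA R A) (@cstar_mul1r R A)
    (@cstar_mulr1 R A) (@cstar_mulDl R A) (@cstar_mulDr R A).

(* The data of a right inner product A-module. Its elements are those of the
   set [carrier]; the operations are total functions on an ambient group and
   their values outside [carrier] are never used. This record carries no
   axioms: it is only used for l_2(A), submodules of l_2(A) and external
   direct sums of these, where the operations are explicit. The action of
   complex scalars is that of the elements l *: 1 of A, so A-linear maps are
   complex linear. *)
Record innerModule (R : realType) (A : cstarAlgType R) := InnerModule {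
  ambient :> zmodType ;
  carrier : set ambient ;
  ract : ambient -> A -> ambient ;
  inner : ambient -> ambient -> A
}.
Arguments InnerModule {R A}.
Arguments carrier {R A}.
Arguments ract {R A} _ _ _.
Arguments inner {R A} _ _ _.

Section InnerModules.
Context {R : realType} {A : cstarAlgType R}.
Implicit Types M N : innerModule A.

(* The standard Hilbert module H_A; its inner product is antilinear in the
   first variable. *)
Definition l2 : innerModule A :=
  InnerModule (nat -> A : zmodType)
    [set x | cvgn (series (fun i => star (x i) * x i))]
    (fun x a i => x i * a)
    (fun x y => limn (series (fun i => star (x i) * y i))).

Definition submod M (S : set M) : innerModule A :=
  InnerModule (ambient M) S (ract M) (inner M).

Definition dsum M N : innerModule A :=
  InnerModule (ambient M * ambient N : zmodType)%type
    (carrier M `*` carrier N)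
    (fun x a => (ract M x.1 a, ract N x.2 a))
    (fun x y => inner M x.1 y.1 + inner N x.2 y.2).

Definition hnorm M (x : M) : R[i] := sqrtC `|inner M x x|.

Definition hclosed M (S : set M) :=
  forall x, carrier M x ->
    (forall e : R[i], 0 < e -> exists2 y, S y & hnorm (x - y) < e) -> S x.

Definition closed_submodule M (S : set M) :=
  [/\ S `<=` carrier M, S 0,
      forall x y, S x -> S y -> S (x + y),
      forall x a, S x -> S (ract M x a) &
      hclosed S].

Definition Alinear M N (T : M -> N) :=
  (forall x y, carrier M x -> carrier M y -> T (x + y) = T x + T y) /\
  (forall x a, carrier M x -> T (ract M x a) = ract N (T x) a).

Definition hbounded M N (T : M -> N) :=
  exists C : R, forall x, carrier M x -> hnorm (T x) <= C%:C * hnorm x.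

(* F restricts to an element of B^a(M). *)
Definition bounded_adjointable M (F : M -> M) :=
  [/\ forall x, carrier M x -> carrier M (F x),
      Alinear F,
      hbounded F &
      exists2 G : M -> M, (forall x, carrier M x -> carrier M (G x)) &
        forall x y, carrier M x -> carrier M y ->
          inner M (F x) y = inner M x (G y)].

Definition im M N (F : M -> N) : set N := F @` carrier M.

Definition ker M N (F : M -> N) : set M := [set x | carrier M x /\ F x = 0].

Definition perp M (S : set M) : set M :=
  [set y | carrier M y /\ forall x, S x -> inner M x y = 0].

(* The inverse of a bounded bijection onto a closed submodule is bounded by
   the open mapping theorem, and is not required to be so. *)
Definition preceq M N :=
  exists (T : M -> N) (S : set N),
    [/\ closed_submodule S, Alinear T, hbounded T & set_bij (carrier M) S T].

End InnerModules.
Arguments l2 {R} A.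

Notation "M ⪯ N" := (preceq M N) (at level 70, no associativity).
Notation "M ⊕ N" := (dsum M N) (at level 50, left associativity).

(* Main.v *)
(* Let F be adjointable with closed range and let z lie in im F. By a gliding hump,
   |z| <= c |F^* z|, so s = F F^* is bounded below on im F. Since
   |(s + l) z| >= |s z| for l >= 0 (both s and l are positive), the method of
   continuity from large l down to 0 shows that s maps im F onto im F. Hence
   l_2(A) is the orthogonal sum of ker F and im F^*, and also of ker F^* and im F,
   and im F^* is closed. If P is the projection onto ker F, then x |-> (F x, P x)
   maps ker (D F) bijectively onto (ker D `&` im F) (+) ker F, which is closed in
   ker D (+) ker F. The relation for the orthogonal complements is the same
   statement for the adjoints, because (im B)^perp = ker B^*.

   The order theory of A behind the Cauchy-Schwarz inequality is obtained without
   spectra: positive elements are squares of selfadjoint ones, square roots come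
   from an explicit iteration, and a^* a is positive by the Kelley-Vaught
   argument. *)
Require Import Defs.
From HB Require Import structures.
From mathcomp Require Import all_boot all_order all_algebra.
From mathcomp Require Import complex.
From mathcomp Require Import all_classical all_reals all_analysis.
From mathcomp Require Import lra ring.

Set Implicit Arguments.
Unset Strict Implicit.
Unset Printing Implicit Defensive.

Import Order.TTheory GRing.Theory Num.Theory numFieldNormedType.Exports.
Local Open Scope classical_set_scope.
Local Open Scope complex_scope.
Local Open Scope ring_scope.

(** * Real-valued norm and limits in a C*-algebra *)

Section RealNorm.
Context {R : realType} {A : cstarAlgType R}.
Implicit Types (a b c h k : A) (r s t : R).

Definition nm a : R := complex.Re `|a|.

Lemma normE a : `|a| = (nm a)%:C.
Proof. by rewrite /nm RRe_real // normr_real. Qed.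

Lemma nm_ge0 a : 0 <= nm a.
Proof. by rewrite -ler0c -normE. Qed.

Lemma nm0 : nm 0 = 0.
Proof. by rewrite /nm normr0. Qed.

Lemma nm0_eq0 a : nm a = 0 -> a = 0.
Proof. by move=> h; apply/eqP; rewrite -normr_eq0 normE h. Qed.

Lemma nmN a : nm (- a) = nm a.
Proof. by rewrite /nm normrN. Qed.

Lemma nmD a b : nm (a + b) <= nm a + nm b.
Proof. by rewrite -lecR rmorphD/= -!normE ler_normD. Qed.

Lemma nmB a b : nm (a - b) <= nm a + nm b.
Proof. by rewrite -(nmN b) nmD. Qed.

Lemma nmBC a b : nm (a - b) = nm (b - a).
Proof. by rewrite -nmN opprB. Qed.

Lemma nmM a b : nm (a * b) <= nm a * nm b.
Proof. by rewrite -lecR rmorphM/= -!normE; apply: cstar_normM. Qed.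

Lemma nmZC (l : R[i]) a : nm (l *: a) = complex.Re `|l| * nm a.
Proof.
by apply: complexI; rewrite -normE normrZ rmorphM/= RRe_real ?normr_real// -normE.
Qed.

Lemma nmZ r a : nm (r%:C *: a) = `|r| * nm a.
Proof. by rewrite nmZC normc_def/= expr0n/= addr0 sqrtr_sqr. Qed.

Lemma scrAl (l : R[i]) a b : l *: (a * b) = (l *: a) * b.
Proof. exact: cstar_scalerAl. Qed.

Lemma scrAr (l : R[i]) a b : l *: (a * b) = a * (l *: b).
Proof. exact: cstar_scalerAr. Qed.

Lemma starDE a b : star (a + b) = star a + star b.
Proof. exact: starD. Qed.

Lemma starME a b : star (a * b) = star b * star a.
Proof. exact: starM. Qed.

Lemma star0 : star (0 : A) = 0.
Proof. by apply: (@addrI _ (star 0)); rewrite -starDE !addr0. Qed.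

Lemma starN a : star (- a) = - star a.
Proof. by apply: (@addrI _ (star a)); rewrite -starDE !subrr star0. Qed.

Lemma starB a b : star (a - b) = star a - star b.
Proof. by rewrite starDE starN. Qed.

Lemma star1 : star (1 : A) = 1.
Proof.
by rewrite -[LHS]mulr1 -{2}(starK (1 : A)) -starME mulr1 starK.
Qed.

Lemma starZr r a : star (r%:C *: a) = r%:C *: star a.
Proof. by rewrite starZ; congr (_ *: _); exact: conjc_real. Qed.

Lemma starZi a : star ('i *: a) = - ('i *: star a).
Proof.
rewrite starZ -scaleNr; congr (_ *: _).
by apply/eqP; rewrite eq_complex/= oppr0 !eqxx.
Qed.

Lemma star_sum (I : Type) (s : seq I) (P : pred I) (f : I -> A) :
  star (\sum_(i <- s | P i) f i) = \sum_(i <- s | P i) star (f i).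
Proof. exact: (big_morph star starDE star0). Qed.

Lemma nm_cstar a : nm (star a * a) = nm a ^+ 2.
Proof. by apply: complexI; rewrite -normE rmorphXn/= -normE; apply: cstar_norm. Qed.

(** The C*-identity gives [|b|^2 = |b^* b| <= |b^*| |b|]; cancel [|b|] and use this for both [b] and
    [b^*]. *)
Lemma nm_star a : nm (star a) = nm a.
Proof.
suff le b : nm b <= nm (star b) by apply/le_anti; rewrite le andbT -{2}(starK a) le.
have [->|b0] := eqVneq (nm b) 0; first exact: nm_ge0.
have bp : 0 < nm b by rewrite lt_neqAle eq_sym b0 nm_ge0.
by rewrite -(ler_pM2r bp) -expr2 -nm_cstar nmM.
Qed.

Lemma nm_sqr h : star h = h -> nm (h * h) = nm h ^+ 2.
Proof. by move=> sh; rewrite -[X in X * _]sh nm_cstar. Qed.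

(** [|1|] equals its own square, hence is [0] or [1]; the value [0] occurs in the zero algebra. *)
Lemma nm1_le1 : nm (1 : A) <= 1.
Proof.
have := nm_sqr star1; rewrite mulr1 => /esym/eqP.
rewrite -subr_eq0 expr2 -{3}[nm 1]mulr1 -mulrBr mulf_eq0 => /orP[/eqP->//|].
by rewrite subr_eq0 => /eqP->.
Qed.

(** Tolerances are taken in the totally ordered field [R], whereas the norm of [A] has values in
    [R[i]]. *)
Definition tends (u : nat -> A) a :=
  forall e : R, 0 < e -> exists N, forall n, (N <= n)%N -> nm (u n - a) < e.

Lemma tendsP (u : nat -> A) a : tends u a <-> u @ \oo --> a.
Proof.
split=> [ua|/cvgrPdist_lt ua e e0].
  apply/cvgrPdist_lt => e e0.
  have er : (complex.Re e)%:C = e by rewrite RRe_real// gtr0_real.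
  have [N hN] := ua (complex.Re e) ltac:(by rewrite -ltcR er).
  by exists N => // n /= Nn; rewrite distrC normE -er ltcR hN.
have [|N _ hN] := ua e%:C; first by rewrite ltcR.
by exists N => n Nn; rewrite nmBC -ltcR -normE hN.
Qed.

Lemma nm_complete (u : nat -> A) :
  (forall e, 0 < e -> exists N, forall m n, (N <= m)%N -> (N <= n)%N ->
     nm (u m - u n) < e) ->
  exists a, tends u a.
Proof.
move=> uC; exists (limn u); apply/tendsP/cauchy_cvgP/cauchy_ballP => e e0.
have er : (complex.Re e)%:C = e by rewrite RRe_real// gtr0_real.
have [N hN] := uC (complex.Re e) ltac:(by rewrite -ltcR er).
pose B := [set u n | n in [set n | (N <= n)%N]].
exists (B, B).
  by split; exists N => // n Nn /=; exists n.
move=> [_ _] /= [[m Nm <-] [n Nn <-]].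
by rewrite -ball_normE /= normE -er ltcR hN.
Qed.

Lemma tends_unique u a b : tends u a -> tends u b -> a = b.
Proof.
move=> /tendsP ua /tendsP ub.
by rewrite -(cvg_lim (@norm_hausdorff _ A) ua) (cvg_lim (@norm_hausdorff _ A) ub).
Qed.

Lemma tends_cst a : tends (fun=> a) a.
Proof. by move=> e e0; exists 0%N => n _; rewrite subrr nm0. Qed.

Lemma tends_le u a r : (exists N, forall n, (N <= n)%N -> nm (u n) <= r) ->
  tends u a -> nm a <= r.
Proof.
move=> [M ur] ua; apply/ler_addgt0Pr => e e0.
have [N hN] := ua _ e0.
have := hN _ (leq_maxl N M); have := ur _ (leq_maxr N M).
set n := maxn N M; have := nmB (u n) (u n - a).
by rewrite opprB addrC subrK; lra.
Qed.

(** A Lipschitz estimate at the limit point suffices; it yields the continuity of one-sided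
    multiplication, [star] and scaling. *)
Lemma tends_lip (f : A -> A) (C : R) u a :
  (forall x, nm (f x - f a) <= C * nm (x - a)) ->
  tends u a -> tends (fun n => f (u n)) (f a).
Proof.
move=> fC ua e e0.
have C0 : 0 < Num.max C 1 by rewrite lt_max ltr01 orbT.
have [N hN] := ua (e / Num.max C 1) ltac:(by rewrite divr_gt0).
exists N => n /hN; rewrite ltr_pdivlMr// => h.
apply: le_lt_trans (fC _) _; apply: le_lt_trans h.
by rewrite mulrC ler_wpM2l ?nm_ge0// le_max lexx.
Qed.

Lemma tendsD u v a b : tends u a -> tends v b ->
  tends (fun n => u n + v n) (a + b).
Proof.
move=> ua vb e e0.
have [N hN] := ua (e / 2) ltac:(lra); have [M hM] := vb (e / 2) ltac:(lra).
exists (maxn N M) => n; rewrite geq_max => /andP[/hN h1 /hM h2].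
by rewrite opprD addrACA; apply: le_lt_trans (nmD _ _) _; lra.
Qed.

Lemma tendsMr u a b : tends u a -> tends (fun n => u n * b) (a * b).
Proof.
apply: (@tends_lip ( *%R^~ b) (nm b)) => x.
by rewrite -mulrBl mulrC nmM.
Qed.

Lemma tendsMl u a b : tends u a -> tends (fun n => b * u n) (b * a).
Proof.
by apply: (@tends_lip ( *%R b) (nm b)) => x; rewrite -mulrBr nmM.
Qed.

Lemma tends_star u a : tends u a -> tends (fun n => star (u n)) (star a).
Proof.
by apply: (@tends_lip star 1) => x; rewrite -starB nm_star mul1r.
Qed.

Lemma tendsZ (l : R[i]) u a : tends u a -> tends (fun n => l *: u n) (l *: a).
Proof.
apply: (@tends_lip ( *:%R l) (complex.Re `|l|)) => x.
by rewrite -scalerBr nmZC.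
Qed.

Lemma tendsB u v a b : tends u a -> tends v b ->
  tends (fun n => u n - v n) (a - b).
Proof.
move=> ua /(tendsZ (-1)) vb.
have := tendsD ua vb; rewrite scaleN1r.
by under eq_fun do rewrite scaleN1r.
Qed.

Lemma tends_sum u (a : nat -> A) m n : (forall i, tends (u^~ i) (a i)) ->
  tends (fun j => \sum_(m <= i < n) u j i) (\sum_(m <= i < n) a i).
Proof.
move=> ua; elim: n => [|n IH].
  by rewrite big_geq//; under eq_fun do rewrite big_geq//; exact: tends_cst.
have [mn|nm] := leqP m n.
  rewrite big_nat_recr//=; under eq_fun do rewrite big_nat_recr//=.
  exact: tendsD.
by rewrite big_geq//; under eq_fun do rewrite big_geq//; exact: tends_cst.
Qed.

Lemma tends_shift u a : tends u a -> tends (fun n => u n.+1) a.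
Proof. by move=> ua e /ua[N hN]; exists N => n Nn; apply: hN; rewrite leqW. Qed.

End RealNorm.

(** * Square roots and positive elements *)

Section Positivity.
Context {R : realType} {A : cstarAlgType R}.
Implicit Types (a b c h k u v : A) (r s t : R).

Lemma tendsM (x y : nat -> A) a b : tends x a -> tends y b ->
  tends (fun n => x n * y n) (a * b).
Proof.
move=> xa yb e e0.
have c0 : 0 < nm b + 1 + nm a by have := nm_ge0 a; have := nm_ge0 b; lra.
have [N hN] := xa (e / (nm b + 1 + nm a)) ltac:(by rewrite divr_gt0).
have [M hM] := yb (Num.min 1 (e / (nm b + 1 + nm a)))
  ltac:(by rewrite lt_min ltr01 divr_gt0).
exists (maxn N M) => n; rewrite geq_max => /andP[/hN + /hM].
rewrite lt_min !ltr_pdivlMr// => h1 /andP[h2 h3].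
have -> : x n * y n - a * b = (x n - a) * y n + a * (y n - b).
  by rewrite mulrBl mulrBr addrA subrK.
apply: le_lt_trans (nmD _ _) _.
have h4 : nm (y n) <= nm b + 1.
  by rewrite -(subrK b (y n)) addrC; apply: le_trans (nmD _ _) _; lra.
apply: le_lt_trans (lerD (nmM _ _) (nmM _ _)) _.
have h5 : nm (x n - a) * nm (y n) <= nm (x n - a) * (nm b + 1).
  by rewrite ler_wpM2l ?nm_ge0.
have [a0|a0] : nm a = 0 \/ 0 < nm a.
- by have := nm_ge0 a; rewrite le_eqVlt => /orP[/eqP|]; auto.
- by rewrite a0 mul0r addr0 in h1 *; apply: le_lt_trans h1; move: h5; rewrite addr0.
move: h1 h3 h5; move: (nm_ge0 b) (nm_ge0 (x n - a)) (nm_ge0 (y n - b)).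
move: (nm a) (nm b) (nm (x n - a)) (nm (y n - b)) (nm (y n)) a0 {h4 hN hM h2 c0}.
by move=> *; nra.
Qed.

Lemma half_double a : (2^-1)%:C *: (a + a) = a.
Proof.
rewrite -{1 2}(scale1r a) -scalerDl scalerA -[1 + 1](rmorphD (real_complex R) 1 1).
by rewrite -rmorphM mulVf ?scale1r.
Qed.

Lemma scaleii a : 'i *: ('i *: a) = - a.
Proof. by rewrite scalerA -expr2 sqrCi scaleN1r. Qed.

Fixpoint sqrt_iter (x : A) n : A :=
  if n is m.+1 then (2^-1)%:C *: (x + sqrt_iter x m * sqrt_iter x m) else 0.

Fixpoint sqrt_bound n : R :=
  if n is m.+1 then 2^-1 * (1 + sqrt_bound m ^+ 2) else 0.

Lemma sqrt_bound_ge0 n : 0 <= sqrt_bound n.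
Proof. by elim: n => //= n IH; rewrite mulr_ge0// addr_ge0// exprn_ge0. Qed.

Lemma sqrt_bound_le1 n : sqrt_bound n <= 1.
Proof. by elim: n => [|n IH] /=; [lra|have := sqrt_bound_ge0 n; nra]. Qed.

Lemma sqrt_bound_nondecreasing n : sqrt_bound n <= sqrt_bound n.+1.
Proof. by elim: n => [|n IH] /=; [lra|have := sqrt_bound_ge0 n; move: IH => /=; nra]. Qed.

Lemma sqrt_iter_star x n : star x = x -> star (sqrt_iter x n) = sqrt_iter x n.
Proof.
move=> sx; elim: n => [|n IH] /=; first exact: star0.
by rewrite starZr starDE starME IH sx.
Qed.

Lemma sqrt_iter_comm x c n : c * x = x * c ->
  c * sqrt_iter x n = sqrt_iter x n * c.
Proof.
move=> cx; elim: n => [|n IH] /=; first by rewrite mulr0 mul0r.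
by rewrite -scrAl -scrAr mulrDl mulrDr cx mulrA IH -!mulrA IH.
Qed.

Lemma sqrt_iter_le x n : nm x <= 1 -> nm (sqrt_iter x n) <= sqrt_bound n.
Proof.
move=> x1; elim: n => [|n IH] /=; first by rewrite nm0.
rewrite nmZ ger0_norm// ler_wpM2l//; apply: le_trans (nmD _ _) _.
rewrite lerD//; apply: le_trans (nmM _ _) _.
by rewrite expr2 ler_pM ?nm_ge0.
Qed.

(** The iterates commute, so an increment is half of [(y - z) * (y + z)], and the scalar increments
    factor in the same way. *)
Lemma sqrt_iter_step x n : nm x <= 1 ->
  nm (sqrt_iter x n.+1 - sqrt_iter x n) <= sqrt_bound n.+1 - sqrt_bound n.
Proof.
move=> x1; elim: n => [|n IH].
  by rewrite /= !subr0 mulr0 addr0 expr0n/= addr0 nmZ ger0_norm// mulr1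
    ler_piMr.
set y := sqrt_iter x n.+1 in IH *; set z := sqrt_iter x n in IH *.
have zy : z * y = y * z.
  by apply: sqrt_iter_comm; apply/esym/sqrt_iter_comm.
have -> : sqrt_iter x n.+2 - y = (2^-1)%:C *: ((y - z) * (y + z)).
  rewrite {2}/y /= -/y -/z -scalerBr opprD addrACA subrr add0r.
  by rewrite mulrBl !mulrDr zy opprD addrA addrK.
have -> : sqrt_bound n.+2 - sqrt_bound n.+1 =
    2^-1 * ((sqrt_bound n.+1 - sqrt_bound n) * (sqrt_bound n.+1 + sqrt_bound n)).
  by rewrite {1}/sqrt_bound -/sqrt_bound /=; field.
rewrite nmZ ger0_norm// ler_wpM2l//; apply: le_trans (nmM _ _) _.
rewrite ler_pM ?nm_ge0//; apply: le_trans (nmD _ _) _.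
by rewrite lerD ?sqrt_iter_le.
Qed.

Lemma sqrt_iter_cauchy x : nm x <= 1 -> exists y, tends (sqrt_iter x) y.
Proof.
move=> x1.
have nd : nondecreasing_seq sqrt_bound.
  by apply/nondecreasing_seqP; exact: sqrt_bound_nondecreasing.
have cv : cvgn sqrt_bound.
  apply: nondecreasing_is_cvgn => //.
  by exists 1 => _ [n _ <-]; exact: sqrt_bound_le1.
have dist m n : (n <= m)%N ->
    nm (sqrt_iter x m - sqrt_iter x n) <= limn sqrt_bound - sqrt_bound n.
  move=> nm; apply: (@le_trans _ _ (sqrt_bound m - sqrt_bound n)); last first.
    by rewrite lerD2r; exact: nondecreasing_cvgn_le.
  rewrite -(subnK nm); elim: (m - n)%N => [|j IH].
    by rewrite add0n !subrr nm0.
  rewrite addSn -(subrK (sqrt_iter x (j + n)) (sqrt_iter x _.+1)) -addrA.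
  apply: le_trans (nmD _ _) _.
  rewrite -(subrK (sqrt_bound (j + n)) (sqrt_bound _.+1)) -addrA.
  by rewrite lerD// sqrt_iter_step.
apply: nm_complete => e e0.
have /cvgrPdist_lt /(_ (e / 2) ltac:(lra)) [N _ hN] := cv.
have := hN N (leqnn N); rewrite /= => /(le_lt_trans (ler_norm _)) h.
exists N => m n /dist hm /dist hn.
have := nmB (sqrt_iter x m - sqrt_iter x N) (sqrt_iter x n - sqrt_iter x N).
by rewrite opprB addrA subrK; lra.
Qed.

(* With [x = 1 - h], the iteration [y <- (x + y^2)/2] started at [0] converges to
   [1 - sqrt h]; the scalar iteration with [x = 1] majorizes its increments. *)
Lemma sqrt_near1 h : star h = h -> nm (1 - h) <= 1 ->
  exists k, [/\ star k = k, k * k = h, nm (1 - k) <= 1 &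
    forall c, c * h = h * c -> c * k = k * c].
Proof.
move=> sh h1; set x := 1 - h in h1.
have sx : star x = x by rewrite starB star1 sh.
have [y hy] := sqrt_iter_cauchy h1.
have yE : y = (2^-1)%:C *: (x + y * y).
  apply: tends_unique (tends_shift hy) _ => /=.
  by apply: tendsZ; apply: tendsD; [exact: tends_cst|exact: tendsM].
have y2 : y + y = x + y * y.
  rewrite {1 2}yE -scalerDl -rmorphD/=.
  have -> : 2^-1 + 2^-1 = 1 :> R by field.
  by rewrite scale1r.
exists (1 - y); split.
- rewrite starB star1; congr (_ - _).
  apply: tends_unique (tends_star hy) _.
  by under eq_fun do rewrite sqrt_iter_star//.
- rewrite mulrBl mul1r mulrBr mulr1 opprB addrACA -opprD y2.
  by rewrite opprD addrACA subrr addr0 /x opprB addrC subrK.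
- rewrite opprB addrC subrK; apply: tends_le hy.
  exists 0%N => n _; exact: le_trans (sqrt_iter_le _ h1) (sqrt_bound_le1 n).
- move=> c ch; rewrite mulrBl mulrBr mul1r mulr1; congr (_ - _).
  apply: tends_unique (tendsMl c hy) _.
  under eq_fun do rewrite (@sqrt_iter_comm x c) ?mulrBl ?mulrBr ?mul1r ?mulr1 ?ch//.
  exact: tendsMr.
Qed.

Definition sc r : A := r%:C *: (1 : A).

Lemma scM r a : sc r * a = r%:C *: a.
Proof. by rewrite -scrAl mul1r. Qed.

Lemma Msc r a : a * sc r = r%:C *: a.
Proof. by rewrite -scrAr mulr1. Qed.

Lemma scD r s : sc (r + s) = sc r + sc s.
Proof. by rewrite /sc rmorphD scalerDl. Qed.

Lemma star_sc r : star (sc r) = sc r.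
Proof. by rewrite starZr star1. Qed.

Lemma nm_sc_le r : 0 <= r -> nm (sc r) <= r.
Proof. by move=> r0; rewrite nmZ ger0_norm// ler_piMr// nm1_le1. Qed.

Lemma scalerrA r s a : r%:C *: (s%:C *: a) = (r * s)%:C *: a.
Proof. by rewrite scalerA -rmorphM. Qed.

(* [u] is the average of [u + iv] and its adjoint, and
   [(u - iv)(u + iv) = u^2 + v^2]. *)
Lemma nm_sqr_le_comm u v : star u = u -> star v = v -> u * v = v * u ->
  nm u ^+ 2 <= nm (u * u + v * v).
Proof.
move=> su sv uv; pose w := u + 'i *: v.
have sw : star w = u - 'i *: v by rewrite starDE starZi su sv.
have -> : u * u + v * v = star w * w.
  rewrite sw mulrBl !mulrDr -!scrAr -!scrAl uv opprD addrA addrK.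
  by rewrite scaleii opprK.
rewrite nm_cstar lerXn2r ?nnegrE ?nm_ge0//.
have -> : u = (2^-1)%:C *: (w + star w).
  by rewrite sw addrACA subrr addr0 half_double.
rewrite nmZ ger0_norm//; have := nmD w (star w); rewrite nm_star.
by have := nm_ge0 w; lra.
Qed.

(* By the square root construction this agrees with positivity of the spectrum;
   [pos_dist] and [pos_of_dist] are its norm characterization. *)
Definition pos h := exists2 k, star k = k & h = k * k.

Lemma pos_star h : pos h -> star h = h.
Proof. by move=> [k sk ->]; rewrite starME sk. Qed.

Lemma pos0 : pos 0.
Proof. by exists 0; rewrite ?star0 ?mulr0. Qed.

(** Rescaling by [t^-1] moves [h] into the unit ball around [1], where [sqrt_near1] applies. The
    root is again near a positive scalar, which makes it positive in [pos_sqrt]. *)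
Lemma pos_sqrt_of_dist h t : star h = h -> 0 < t -> nm (sc t - h) <= t ->
  exists k, [/\ star k = k, k * k = h, exists2 s, 0 < s & nm (sc s - k) <= s &
    forall c, c * h = h * c -> c * k = k * c].
Proof.
move=> sh t0 ht.
have tE : t * t^-1 = 1 by rewrite divff ?gt_eqF.
have st : Num.sqrt t * Num.sqrt t = t by rewrite -expr2 sqr_sqrtr// ltW.
have s0 : 0 < Num.sqrt t by rewrite sqrtr_gt0.
have [||k [sk kk k1 kc]] := @sqrt_near1 (t^-1%:C *: h).
- by rewrite starZr sh.
- have -> : 1 - t^-1%:C *: h = t^-1%:C *: (sc t - h).
    by rewrite scalerBr scalerrA mulrC tE scale1r.
  have ti0 : 0 < t^-1 by rewrite invr_gt0.
  by rewrite nmZ gtr0_norm// mulrC ler_pdivrMr// mul1r.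
exists ((Num.sqrt t)%:C *: k); split.
- by rewrite starZr sk.
- by rewrite -scrAl -scrAr scalerrA st kk scalerrA tE scale1r.
- exists (Num.sqrt t) => //; rewrite -scalerBr nmZ gtr0_norm//.
  by rewrite ler_piMr// ltW.
- by move=> c ch; rewrite -scrAl -scrAr kc// -scrAl -scrAr ch.
Qed.

Lemma pos_of_dist h t : star h = h -> 0 < t -> nm (sc t - h) <= t -> pos h.
Proof.
by move=> sh t0 /(pos_sqrt_of_dist sh t0) [k [sk kk _ _]]; exists k.
Qed.

(** Since [|t - (t - h)| = |h| <= t], the element [t - h] has a selfadjoint root [j], and [j]
    commutes with the root [k] of [h]. Then [|t - h| = |j|^2 <= |j^2 + k^2| <= t]. *)
Lemma pos_dist h t : pos h -> 0 < t -> nm h <= t -> nm (sc t - h) <= t.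
Proof.
move=> [k sk ->] t0 kt.
have [||j [sj jj _ jc]] := @pos_sqrt_of_dist (sc t - k * k) t _ t0.
- by rewrite starB star_sc starME sk.
- by rewrite opprB addrC subrK.
rewrite -jj nm_sqr//; apply: le_trans (@nm_sqr_le_comm j k _ _ _) _ => //.
  by apply/esym/jc; rewrite mulrBl mulrBr scM Msc mulrA.
by rewrite jj subrK nm_sc_le// ltW.
Qed.

Lemma pos_sqrt h : pos h ->
  exists k, [/\ star k = k, pos k, k * k = h &
    forall c, c * h = h * c -> c * k = k * c].
Proof.
move=> hp; have t0 : 0 < nm h + 1 by have := nm_ge0 h; lra.
have [k [sk kk [s s0 ks] kc]] :=
  pos_sqrt_of_dist (pos_star hp) t0 (pos_dist hp t0 ltac:(lra)).
by exists k; split=> //; exact: pos_of_dist ks.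
Qed.

(** In the norm characterization, two bounds [|t - h| <= t] and [|s - k| <= s] add up by the
    triangle inequality. *)
Lemma posD h k : pos h -> pos k -> pos (h + k).
Proof.
move=> hp kp.
have h0 : 0 < nm h + 1 by have := nm_ge0 h; lra.
have k0 : 0 < nm k + 1 by have := nm_ge0 k; lra.
apply: (@pos_of_dist _ ((nm h + 1) + (nm k + 1))); last 1 first.
- rewrite scD opprD addrACA; apply: le_trans (nmD _ _) _.
  by rewrite lerD// pos_dist//; lra.
- by rewrite starDE !pos_star.
- exact: addr_gt0.
Qed.

Lemma posZ r h : 0 <= r -> pos h -> pos (r%:C *: h).
Proof.
move=> r0 [k sk ->]; exists ((Num.sqrt r)%:C *: k); first by rewrite starZr sk.
by rewrite -scrAl -scrAr scalerrA -(expr2 (Num.sqrt r)) sqr_sqrtr.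
Qed.

Lemma pos_sc_sub h t : star h = h -> 0 < t -> nm h <= t -> pos (sc t - h).
Proof.
move=> sh t0 ht; apply: (@pos_of_dist _ t) => //.
  by rewrite starB star_sc sh.
by rewrite opprB addrC subrK.
Qed.

(** For [t] slightly above [|h + k|], both [h] and [t - h] are squares, of commuting [u] and [v], so
    [|h| = |u|^2 <= |u^2 + v^2| <= t]. *)
Lemma pos_nm_le h k : pos h -> pos k -> nm h <= nm (h + k).
Proof.
move=> hp kp; apply/ler_addgt0Pr => e e0; set t := _ + e.
have t0 : 0 < t by rewrite ltr_wpDl// nm_ge0.
have : pos (sc t - h).
  have -> : sc t - h = (sc t - (h + k)) + k by rewrite opprD addrA subrK.
  apply: posD => //; apply: pos_sc_sub => //; first by rewrite pos_star//; exact: posD.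
  by rewrite /t lerDl ltW.
move: hp => [u su hE] /pos_sqrt [v [sv _ vv vc]].
have uv : u * v = v * u by apply: vc; rewrite mulrBl mulrBr Msc scM hE mulrA.
have := nm_sqr_le_comm su sv uv; rewrite -nm_sqr// -hE vv addrC subrK => /le_trans.
by apply; rewrite nm_sc_le// ltW.
Qed.

Lemma pos_antisym h : pos h -> pos (- h) -> h = 0.
Proof.
move=> hp hn; apply: nm0_eq0; apply/le_anti; rewrite nm_ge0 andbT.
by have := pos_nm_le hp hn; rewrite subrr nm0.
Qed.

(** The exponents are those for which repeated squaring gives [|W^n| = |W|^n] for selfadjoint [W].
    If [r = 1 + d] with [d > 0], the square of Bernoulli's inequality grows quadratically, against a
    linear bound. *)
Lemma le1_of_expr_bound r : (forall j : nat, r ^+ (2 ^ j) <= 1 + (2 ^ j)%:R) -> r <= 1.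
Proof.
move=> hr; rewrite leNgt; apply/negP => r1; set d := r - 1.
have d0 : 0 < d by rewrite subr_gt0.
have bern n : 1 + n%:R * d <= r ^+ n.
  elim: n => [|n IH]; first by rewrite mul0r addr0 expr0.
  rewrite exprSr -natr1; have -> : r = 1 + d by rewrite /d; ring.
  rewrite -/d; move: IH; have -> : r = 1 + d by rewrite /d; ring.
  move=> IH; apply: le_trans (ler_wpM2r _ IH); last by lra.
  have : 0 <= n%:R :> R by []. 
  by nra.
(* With [N = 2 ^ j] and [N d^2 >= 2], the square of [1 + N d] exceeds [1 + 2 N]. *)
have [j hk] : exists j : nat, 2 / d ^+ 2 <= (2 ^ j)%:R.
  exists (Num.bound (2 / d ^+ 2)).
  apply: le_trans (_ : (Num.bound (2 / d ^+ 2))%:R <= _).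
    by apply/ltW/archi_boundP; rewrite divr_ge0// ltW// exprn_gt0.
  by rewrite ler_nat ltnW// ltn_expl.
have := hr j.+1; rewrite expnS mulnC exprM natrM.
have N0 : 0 <= (2 ^ j)%:R :> R by [].
have := bern (2 ^ j)%N; move: hk; rewrite ler_pdivrMr ?exprn_gt0//.
have N1 : 1 <= (2 ^ j)%:R :> R by rewrite ler1n expn_gt0.
set N : R := (2 ^ j)%:R in N0 N1 *; set p := r ^+ _.
move=> h1 h2 h3.
have : (1 + N * d) ^+ 2 <= p ^+ 2.
  by rewrite lerXn2r// ?nnegrE; nra.
have : N * 2 <= N * (N * d ^+ 2) by rewrite ler_wpM2l.
by nra.
Qed.

(* [1 - c^*c] and [1 - c c^*] are intertwined by [c], so the powers of the former
   grow at most linearly; being selfadjoint it then has norm at most [1]. *)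
Lemma neg_star_mul_eq0_aux c : nm c <= 1 -> pos (- (star c * c)) -> c = 0.
Proof.
move=> c1 cn; set q := - _ in cn.
have pp : pos (c * star c).
  (* [c * star c + star c * c] is half the sum of the squares of the selfadjoint elements
     [c + star c] and ['i *: (c - star c)]; adding [q] removes [star c * c]. *)
  have -> : c * star c = (2^-1)%:C *: ((c + star c) * (c + star c) +
      ('i *: (c - star c)) * ('i *: (c - star c))) + q.
    rewrite -scrAl -scrAr scaleii.
    have -> : (c + star c) * (c + star c) =
        (c * c + star c * star c) + (c * star c + star c * c).
      by rewrite mulrDl !mulrDr [star c * c + _]addrC addrACA.
    have -> : (c - star c) * (c - star c) =
        (c * c + star c * star c) - (c * star c + star c * c).
      by rewrite mulrBl !mulrBr opprB addrACA -opprD.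
    have e (x y : A) : x + y - (x - y) = y + y by rewrite opprB addrC addrA subrK.
    by rewrite e half_double addrK.
  apply: posD => //; apply: posZ => //; apply: posD.
    by exists (c + star c) => //; rewrite starDE starK addrC.
  exists ('i *: (c - star c)) => //.
  by rewrite starZi starB starK -scalerN opprB.
set U := 1 - c * star c; set W := 1 - star c * c.
have sW : star W = W by rewrite starB star1 starME starK.
have U1 : nm U <= 1.
  have -> : U = sc 1 - c * star c by rewrite /sc scale1r.
  apply: pos_dist => //; rewrite -{1}(starK c) nm_cstar nm_star.
  by rewrite expr_le1 ?nm_ge0.
have Wc n : W ^+ n * star c = star c * U ^+ n.
  elim: n => [|n IH]; first by rewrite !expr0 mul1r mulr1.
  rewrite !exprS -mulrA IH !mulrA; congr (_ * _).
  by rewrite mulrBl mulrBr mul1r mulr1 mulrA.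
have Un n : nm (U ^+ n) <= 1.
  elim: n => [|n IH]; first exact: nm1_le1.
  by rewrite exprS; apply: le_trans (nmM _ _) _; rewrite mulr_ile1 ?nm_ge0.
have Wn n : nm (W ^+ n) <= 1 + n%:R.
  elim: n => [|n IH]; first by rewrite addr0 expr0 nm1_le1.
  rewrite exprSr {2}/W mulrBr mulr1 mulrA Wc.
  apply: le_trans (nmB _ _) _; rewrite -natr1 addrA lerD//.
  apply: le_trans (nmM _ _) _; rewrite mulr_ile1 ?nm_ge0//.
  by apply: le_trans (nmM _ _) _; rewrite mulr_ile1 ?nm_ge0 ?nm_star.
have W2 (j : nat) : nm (W ^+ (2 ^ j)) = nm W ^+ (2 ^ j).
  elim: j => [//|j IH]; rewrite expnS mulnC !exprM expr2 nm_sqr ?IH//.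
  elim: (2 ^ j)%N => [|n IHn]; first by rewrite expr0 star1.
  by rewrite {1}exprS starME IHn sW -exprSr.
have W1 : nm W <= 1 by apply: le1_of_expr_bound => j; rewrite -W2 Wn.
(* By [pos_of_dist], the bound [W1] makes [- q] positive as well. *)
have q0 : q = 0.
  apply: pos_antisym => //; apply: (@pos_of_dist _ 1) => //.
    by rewrite starN pos_star.
  by rewrite /sc scale1r /q opprK.
apply: nm0_eq0; apply/eqP; rewrite -sqrf_eq0 -nm_cstar; apply/eqP.
by rewrite -nmN -/q q0 nm0.
Qed.

End Positivity.

(** * Positivity of [a^* a] and the Cauchy-Schwarz inequality for finite sums *)

Section StarMul.
Context {R : realType} {A : cstarAlgType R}.
Implicit Types (a b c h k u v : A) (r s t : R).

Lemma neg_star_mul_eq0 c : pos (- (star c * c)) -> c = 0.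
Proof.
move=> cn; have [->//|c0] := eqVneq c 0.
have n0 : 0 < nm c.
  by rewrite lt_neqAle nm_ge0 andbT eq_sym; apply: contra_neq c0 => /nm0_eq0.
have ni : 0 < (nm c)^-1 by rewrite invr_gt0.
have : (nm c)^-1%:C *: c = 0.
  apply: neg_star_mul_eq0_aux.
    by rewrite nmZ gtr0_norm// mulVf ?gt_eqF.
  by rewrite starZr -scrAl -scrAr scalerrA -scalerN; apply: posZ; rewrite ?mulr_ge0 ?ltW.
move=> /(congr1 ( *:%R (nm c)%:C)); rewrite scalerrA scaler0 divff ?gt_eqF//.
by rewrite scale1r.
Qed.

(* Kelley-Vaught: for [h = a^* a], [m = |h|] and [n = m - h] (twice the negative
   part of [h]), [(an)^*(an) = n h n = - n m n] is negative, so [an = 0]. *)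
Lemma pos_star_mul a : pos (star a * a).
Proof.
set h := star a * a.
have sh : star h = h by rewrite starME starK.
have hp : pos (h * h) by exists h.
have [m [sm mp mm mc]] := pos_sqrt hp.
have hm : h * m = m * h by apply: mc; rewrite mulrA.
(* The root [l] of [m] commutes with [n] and exhibits [n * m * n] as the square of [l * n]. *)
have [l [sl _ ll lc]] := pos_sqrt mp.
pose n := m - h.
have sn : star n = n by rewrite starB sm sh.
have nl : n * l = l * n by apply: lc; rewrite mulrBl mulrBr hm.
have nm' : n * m = m * n by rewrite mulrBl mulrBr hm.
have hn : h * n = - (m * n).
  by rewrite !mulrBr hm mm opprB.
have an : a * n = 0.
  apply: neg_star_mul_eq0; exists (l * n); first by rewrite starME sl sn nl.
  rewrite starME sn -!mulrA [star a * _]mulrA -/h hn mulrN opprK.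
  by rewrite -ll -!mulrA [LHS]mulrA nl -!mulrA.
have hn0 : h * n = 0 by rewrite -mulrA an mulr0.
have mn0 : m * n = 0 by apply/oppr_inj; rewrite -hn hn0 oppr0.
have nn0 : n * n = 0 by rewrite {1}/n mulrBl mn0 hn0 subrr.
have n0 : n = 0.
  by apply: nm0_eq0; apply/eqP; rewrite -sqrf_eq0 -nm_sqr// nn0 nm0.
by move/eqP: n0; rewrite subr_eq0 => /eqP <-.
Qed.

Lemma pos_conj b h : pos h -> pos (star b * h * b).
Proof.
move=> [k sk ->].
have -> : star b * (k * k) * b = star (k * b) * (k * b).
  by rewrite starME sk !mulrA.
exact: pos_star_mul.
Qed.

(** One [t = |a| + 1] serves for all late terms, and the closed condition [|t - u n| <= t] passes to
    the limit. *)
Lemma pos_lim (u : nat -> A) a : (forall n, pos (u n)) -> tends u a -> pos a.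
Proof.
move=> up ua; have t0 : 0 < nm a + 1 by have := nm_ge0 a; lra.
apply: (@pos_of_dist _ _ _ (nm a + 1)) => //.
  apply: tends_unique (tends_star ua) _.
  by under eq_fun do rewrite (pos_star (up _)).
apply: tends_le (tendsB (tends_cst _) ua).
have [N hN] := ua _ ltr01; exists N => n /hN un.
apply: pos_dist => //; rewrite -(subrK a (u n)) addrC.
by apply: le_trans (nmD _ _) _; lra.
Qed.

Lemma pos_sum (I : Type) (s : seq I) (P : pred I) (f : I -> A) :
  (forall i, P i -> pos (f i)) -> pos (\sum_(i <- s | P i) f i).
Proof. by move=> fp; apply: big_ind => //; [exact: pos0|exact: posD]. Qed.

(* The quadratic inequality at [a = - z^-1 *: star Y], with [z > nm Z]. *)
Lemma quadratic_cauchy_schwarz X Y Z : star Z = Z ->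
  (forall a, pos (X + Y * a + star a * star Y + star a * Z * a)) ->
  nm Y ^+ 2 <= nm X * nm Z.
Proof.
move=> sZ XYZ.
have key z : nm Z < z -> nm Y ^+ 2 <= nm X * z.
  move=> Zz; have z0 : 0 < z by apply: le_lt_trans Zz; exact: nm_ge0.
  have zi : 0 < z^-1 by rewrite invr_gt0.
  (* Adding the positive element [z^-2 Y (z - Z) Y^*] to the given one cancels its term in [Z]. *)
  have p1 : pos (X - z^-1%:C *: (Y * star Y)).
    have := posD (XYZ (- (z^-1%:C *: star Y)))
      (posZ (_ : 0 <= z^-1 * z^-1) (pos_conj (star Y) (pos_sc_sub sZ z0 (ltW Zz)))).
    move=> /(_ (mulr_ge0 (ltW zi) (ltW zi))).
    have E4 : (z^-1 * z^-1)%:C *: (star (star Y) * (sc z - Z) * star Y) =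
        z^-1%:C *: (Y * star Y) - (z^-1 * z^-1)%:C *: (Y * Z * star Y).
      rewrite starK mulrBr mulrBl Msc -scrAl scalerBr scalerrA.
      by rewrite -(mulrA z^-1) mulVf ?gt_eqF// mulr1.
    rewrite E4 starN starZr starK mulrN -scrAr !mulNr mulrN opprK -!scrAl -scrAr.
    by rewrite scalerrA [_ *: _ - _]addrC addrA addrK subrK.
  have p2 : pos (z^-1%:C *: (Y * star Y)).
    by apply: posZ; [exact: ltW|rewrite -{1}(starK Y); exact: pos_star_mul].
  have := pos_nm_le p2 p1; rewrite addrC subrK nmZ gtr0_norm//.
  by rewrite -{1}(starK Y) nm_cstar nm_star mulrC ler_pdivrMr.
apply/ler_addgt0Pr => e e0.
have X0 := nm_ge0 X; have X1 : 0 < nm X + 1 by lra.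
apply: le_trans (key (nm Z + e / (nm X + 1)) _) _.
  by rewrite ltrDl divr_gt0.
rewrite mulrDr lerD2l mulrCA ler_piMr ?(ltW e0)// ler_pdivrMr//; lra.
Qed.

(** A block of the inner product of [l2 A]: [m = 0] gives the partial sums, general [m] the
    differences in Cauchy criteria. *)
Definition dot m n (x y : nat -> A) : A := \sum_(m <= i < n) star (x i) * y i.

Lemma dotDr m n x y z : dot m n x (y \+ z) = dot m n x y + dot m n x z.
Proof. by rewrite /dot -big_split/=; apply: eq_bigr => i _; rewrite mulrDr. Qed.

Lemma dotMr m n x y a : dot m n x (fun i => y i * a) = dot m n x y * a.
Proof. by rewrite /dot mulr_suml; apply: eq_bigr => i _; rewrite mulrA. Qed.

Lemma star_dot m n x y : star (dot m n x y) = dot m n y x.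
Proof. by rewrite star_sum; apply: eq_bigr => i _; rewrite starME starK. Qed.

Lemma dotDl m n x y z : dot m n (y \+ z) x = dot m n y x + dot m n z x.
Proof. by rewrite -star_dot dotDr starDE !star_dot. Qed.

Lemma dotMl m n x y a : dot m n (fun i => y i * a) x = star a * dot m n y x.
Proof. by rewrite -star_dot dotMr starME star_dot. Qed.

Lemma pos_dot m n x : pos (dot m n x x).
Proof. by apply: pos_sum => i _; exact: pos_star_mul. Qed.

Lemma dot_cauchy_schwarz m n x y :
  nm (dot m n x y) ^+ 2 <= nm (dot m n x x) * nm (dot m n y y).
Proof.
apply: quadratic_cauchy_schwarz => [|a]; first exact: star_dot.
have := pos_dot m n (x \+ (fun i => y i * a)).
by rewrite dotDr !dotDl !dotMr !dotMl star_dot addrACA addrA.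
Qed.

Definition fnorm m n x : R := Num.sqrt (nm (dot m n x x)).

Lemma fnorm_ge0 m n x : 0 <= fnorm m n x.
Proof. exact: sqrtr_ge0. Qed.

Lemma fnorm_sqr m n x : fnorm m n x ^+ 2 = nm (dot m n x x).
Proof. by rewrite sqr_sqrtr ?nm_ge0. Qed.

Lemma nm_dot_le m n x y : nm (dot m n x y) <= fnorm m n x * fnorm m n y.
Proof.
rewrite -(@ler_pXn2r _ 2) ?nnegrE ?nm_ge0 ?mulr_ge0 ?fnorm_ge0//.
by rewrite exprMn !fnorm_sqr dot_cauchy_schwarz.
Qed.

Lemma fnormD m n x y : fnorm m n (x \+ y) <= fnorm m n x + fnorm m n y.
Proof.
rewrite -(@ler_pXn2r _ 2) ?nnegrE ?addr_ge0 ?fnorm_ge0//.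
rewrite fnorm_sqr dotDr !dotDl.
have := nmD (dot m n x x + dot m n y x) (dot m n x y + dot m n y y).
have := nmD (dot m n x x) (dot m n y x); have := nmD (dot m n x y) (dot m n y y).
have := nm_dot_le m n x y; have := nm_dot_le m n y x.
by rewrite -!fnorm_sqr; nra.
Qed.

Lemma fnormM m n x a : fnorm m n (fun i => x i * a) <= fnorm m n x * nm a.
Proof.
rewrite -(@ler_pXn2r _ 2) ?nnegrE ?mulr_ge0 ?nm_ge0 ?fnorm_ge0//.
rewrite fnorm_sqr dotMr dotMl exprMn fnorm_sqr expr2 mulrA.
apply: le_trans (nmM _ _) _; rewrite ler_wpM2r ?nm_ge0//.
by apply: le_trans (nmM _ _) _; rewrite nm_star mulrC.
Qed.

Lemma fnormN m n x : fnorm m n (fun i => - x i) = fnorm m n x.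
Proof.
by congr (Num.sqrt (nm _)); apply: eq_bigr => i _; rewrite starN mulrNN.
Qed.

Lemma fnorm_geq m n x : (n <= m)%N -> fnorm m n x = 0.
Proof. by move=> nm'; rewrite /fnorm /dot big_geq// nm0 sqrtr0. Qed.

Lemma dot_split m n x y : (m <= n)%N -> dot 0 n x y = dot 0 m x y + dot m n x y.
Proof. by move=> mn; rewrite /dot (@big_cat_nat _ _ _ m). Qed.

(** [star (x i) * x i] is one summand in a sum of positive elements, on which the norm is
    monotone. *)
Lemma nm_coord_le i n x : (i < n)%N -> nm (x i) <= fnorm 0 n x.
Proof.
move=> i_n; rewrite -(@ler_pXn2r _ 2) ?nnegrE ?nm_ge0 ?fnorm_ge0//.
rewrite fnorm_sqr -nm_cstar /dot (bigD1_seq i) ?mem_index_iota ?iota_uniq//=.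
by apply: pos_nm_le; [exact: pos_star_mul|apply: pos_sum => j _; exact: pos_star_mul].
Qed.

End StarMul.
(** * The standard Hilbert module *)

Section RealHnorm.
Context {R : realType} {A : cstarAlgType R}.

Definition nr (M : innerModule A) (x : M) : R := Num.sqrt (nm (inner M x x)).
Arguments nr : clear implicits.

Lemma hnormE (M : innerModule A) (x : M) : hnorm x = (nr M x)%:C.
Proof.
rewrite /hnorm normE -[nm _]sqr_sqrtr ?nm_ge0// rmorphXn/= sqrCK//.
by rewrite ler0c sqrtr_ge0.
Qed.

Lemma nr_ge0 (M : innerModule A) (x : M) : 0 <= nr M x.
Proof. exact: sqrtr_ge0. Qed.

Lemma nr_sqr (M : innerModule A) (x : M) : nr M x ^+ 2 = nm (inner M x x).
Proof. by rewrite sqr_sqrtr ?nm_ge0. Qed.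

Lemma hclosedP (M : innerModule A) (S : set M) : hclosed S <->
  forall x, carrier M x ->
    (forall e : R, 0 < e -> exists2 y, S y & nr M (x - y) < e) -> S x.
Proof.
split=> cS x Mx h; apply: cS => // e e0.
  have er : (complex.Re e)%:C = e by rewrite RRe_real// gtr0_real.
  have [|y Sy xy] := h (complex.Re e); first by rewrite -ltcR er.
  by exists y; rewrite // hnormE -er ltcR.
have [|y Sy] := h e%:C; first by rewrite ltcR.
by rewrite hnormE ltcR; exists y.
Qed.

Lemma hboundedP (M N : innerModule A) (T : M -> N) : hbounded T <->
  exists2 C : R, 0 <= C & forall x, carrier M x -> nr N (T x) <= C * nr M x.
Proof.
split=> [[C hC]|[C _ hC]]; last first.
  by exists C => x /hC; rewrite !hnormE -rmorphM lecR.
exists `|C| => // x /hC; rewrite !hnormE -rmorphM lecR => /le_trans; apply.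
by rewrite ler_wpM2r ?nr_ge0// ler_norm.
Qed.

End RealHnorm.
Arguments nr {R A} M _.

Section L2.
Context {R : realType} {A : cstarAlgType R}.
Local Notation H := (l2 A).
Local Notation L := (carrier H).
Implicit Types (x y z : H) (a : A).

Lemma series_dot x y :
  series (fun i => star (x i) * y i) = (fun n => dot 0 n x y).
Proof. by []. Qed.

Lemma dot_sub m n x y : (m <= n)%N -> dot 0 n x y - dot 0 m x y = dot m n x y.
Proof. by move=> mn; rewrite (dot_split _ _ mn) addrC addKr. Qed.

Lemma nm_dot_sub_le e N m n x y : 0 <= e ->
    (forall m n, (N <= m)%N -> nm (dot m n x y) <= e) ->
  (N <= m)%N -> (N <= n)%N -> nm (dot 0 m x y - dot 0 n x y) <= e.
Proof.
move=> e0 hN Nm Nn; have [mn|/ltnW nm'] := leqP m n.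
  by rewrite nmBC dot_sub// hN.
by rewrite dot_sub// hN.
Qed.

(** The Cauchy criterion in terms of a seminorm on blocks, so that stability under sums and under
    the action of [A] reduces to [fnormD] and [fnormM]. *)
Lemma carrier_fnormP x : L x <->
  forall e : R, 0 < e -> exists N, forall m n, (N <= m)%N -> fnorm m n x < e.
Proof.
split=> [/tendsP Lx e e0|hx].
  have [|N hN] := Lx (e ^+ 2 / 2); first by rewrite divr_gt0 ?exprn_gt0.
  exists N => m n Nm; have [nm'|mn] := leqP n m; first by rewrite fnorm_geq.
  rewrite -(@ltr_pXn2r _ 2) ?nnegrE ?fnorm_ge0 ?(ltW e0)// fnorm_sqr.
  rewrite -dot_sub ?(ltnW mn)//.
  have := hN _ Nm; have := hN n (leq_trans Nm (ltnW mn)); rewrite series_dot.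
  set l := limn _; have := nmB (dot 0 n x x - l) (dot 0 m x x - l).
  by rewrite opprB addrA subrK; lra.
have [|l hl] := @nm_complete _ _ (fun n => dot 0 n x x).
  move=> e e0; have s0 : 0 < Num.sqrt (e / 2) by rewrite sqrtr_gt0 divr_gt0.
  have [N hN] := hx _ s0; exists N => m n Nm Nn.
  apply: (@le_lt_trans _ _ (e / 2)); last by lra.
  apply: nm_dot_sub_le Nm Nn; first by rewrite divr_ge0// ltW.
  move=> p q /hN hp; rewrite -fnorm_sqr -[e / 2]sqr_sqrtr ?divr_ge0 ?(ltW e0)//.
  by rewrite lerXn2r ?nnegrE ?fnorm_ge0 ?sqrtr_ge0// ltW.
by apply/cvg_ex; exists l; apply/tendsP.
Qed.

Lemma carrier0 : L 0.
Proof.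
apply/carrier_fnormP => e e0; exists 0%N => m n _.
by rewrite /fnorm /dot big1 ?nm0 ?sqrtr0// => i _; rewrite mulr0.
Qed.

Lemma carrierD x y : L x -> L y -> L (x + y).
Proof.
move=> /carrier_fnormP hx /carrier_fnormP hy; apply/carrier_fnormP => e e0.
have [N hN] := hx (e / 2) ltac:(lra); have [M hM] := hy (e / 2) ltac:(lra).
exists (maxn N M) => m n; rewrite geq_max => /andP[/hN + /hM].
move=> /(_ n) h1 /(_ n) h2; apply: le_lt_trans (fnormD _ _ _ _) _; lra.
Qed.

Lemma carrierM x a : L x -> L (ract H x a).
Proof.
move=> /carrier_fnormP hx; apply/carrier_fnormP => e e0.
have a0 : 0 < nm a + 1 by have := nm_ge0 a; lra.
have [|N hN] := hx (e / (nm a + 1)); first by rewrite divr_gt0.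
exists N => m n /hN => /(_ n); rewrite ltr_pdivlMr// => h.
apply: le_lt_trans (fnormM _ _ _ _) (le_lt_trans _ h).
by rewrite ler_wpM2l ?fnorm_ge0//; lra.
Qed.

Lemma ractN1 x : ract H x (- 1) = - x.
Proof. by apply/funext => i /=; rewrite mulrN1. Qed.

Lemma carrierN x : L x -> L (- x).
Proof. by rewrite -ractN1; exact: carrierM. Qed.

Lemma carrierB x y : L x -> L y -> L (x - y).
Proof. by move=> Lx /carrierN; exact: carrierD. Qed.

(** Cauchy-Schwarz on blocks makes the mixed partial sums Cauchy. Thus the [limn] in [inner] is a
    genuine limit, and identities pass from [dot] to [inner]. *)
Lemma dot_tends x y : L x -> L y -> tends (fun n => dot 0 n x y) (inner H x y).
Proof.
move=> /carrier_fnormP hx /carrier_fnormP hy.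
have [|l hl] := @nm_complete _ _ (fun n => dot 0 n x y).
  move=> e e0; have [N hN] := hx _ e0; have [M hM] := hy (1 / 2) ltac:(lra).
  exists (maxn N M) => m n Nm Nn.
  apply: (@le_lt_trans _ _ (e / 2)); last by lra.
  apply: nm_dot_sub_le Nm Nn => //; first by rewrite divr_ge0// ltW.
  move=> p q; rewrite geq_max => /andP[/(hN _ q) h1 /(hM _ q) h2].
  apply: le_trans (nm_dot_le _ _ _ _) _.
  by have := fnorm_ge0 p q x; have := fnorm_ge0 p q y; nra.
suff -> : inner H x y = l by [].
by move/tendsP: hl => /(cvg_lim (@norm_hausdorff _ A)).
Qed.

Lemma inner_star x y : L x -> L y -> star (inner H x y) = inner H y x.
Proof.
move=> Lx Ly; apply: tends_unique (tends_star (dot_tends Lx Ly)) _.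
under eq_fun do rewrite star_dot; exact: dot_tends.
Qed.

Lemma innerDr x y z : L x -> L y -> L z ->
  inner H x (y + z) = inner H x y + inner H x z.
Proof.
move=> Lx Ly Lz; apply: (tends_unique (dot_tends Lx (carrierD Ly Lz))).
under eq_fun do rewrite dotDr; exact: tendsD (dot_tends _ _) (dot_tends _ _).
Qed.

Lemma innerMr x y a : L x -> L y -> inner H x (ract H y a) = inner H x y * a.
Proof.
move=> Lx Ly; apply: (tends_unique (dot_tends Lx (@carrierM y a Ly))).
under eq_fun do rewrite dotMr; exact: tendsMr (dot_tends _ _).
Qed.

Lemma innerDl x y z : L x -> L y -> L z ->
  inner H (y + z) x = inner H y x + inner H z x.
Proof.
move=> Lx Ly Lz; have Lyz := carrierD Ly Lz.
by rewrite -inner_star// innerDr// starDE !inner_star.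
Qed.

Lemma innerMl x y a : L x -> L y ->
  inner H (ract H y a) x = star a * inner H y x.
Proof.
move=> Lx Ly; have Lya := @carrierM y a Ly.
by rewrite -inner_star// innerMr// starME inner_star.
Qed.

Lemma innerNr x y : L x -> L y -> inner H x (- y) = - inner H x y.
Proof. by move=> Lx Ly; rewrite -ractN1 innerMr// mulrN1. Qed.

Lemma innerNl x y : L x -> L y -> inner H (- y) x = - inner H y x.
Proof. by move=> Lx Ly; rewrite -ractN1 innerMl// starN star1 mulN1r. Qed.

Lemma innerBr x y z : L x -> L y -> L z ->
  inner H x (y - z) = inner H x y - inner H x z.
Proof. by move=> Lx Ly Lz; rewrite innerDr ?innerNr//; exact: carrierN. Qed.

Lemma innerBl x y z : L x -> L y -> L z ->
  inner H (y - z) x = inner H y x - inner H z x.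
Proof. by move=> Lx Ly Lz; rewrite innerDl ?innerNl//; exact: carrierN. Qed.

Lemma inner_pos x : L x -> pos (inner H x x).
Proof. by move=> Lx; apply: pos_lim (dot_tends Lx Lx) => n; exact: pos_dot. Qed.

(** [inner H x x - dot 0 n x x] is a limit of positive blocks, hence positive. *)
Lemma fnorm_le_nr n x : L x -> fnorm 0 n x <= nr H x.
Proof.
move=> Lx; apply: ler_wsqrtr.
suff : pos (inner H x x - dot 0 n x x).
  by move=> /(pos_nm_le (pos_dot 0 n x)); rewrite addrC subrK.
have := tendsB (dot_tends Lx Lx) (tends_cst (dot 0 n x x)).
have h : forall m, pos (dot 0 (m + n) x x - dot 0 n x x).
  by move=> m; rewrite dot_sub ?leq_addl//; exact: pos_dot.
move=> hl; apply: pos_lim h _ => e /hl [N hN]; exists N => m Nm.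
by apply: hN; rewrite (leq_trans Nm)// leq_addr.
Qed.

Lemma nr_le x r : L x -> 0 <= r -> (forall n, fnorm 0 n x <= r) -> nr H x <= r.
Proof.
move=> Lx r0 hr; rewrite -(@ler_pXn2r _ 2) ?nnegrE ?nr_ge0// nr_sqr.
apply: tends_le (dot_tends Lx Lx); exists 0%N => n _.
by rewrite -fnorm_sqr lerXn2r// nnegrE fnorm_ge0.
Qed.

Lemma cauchy_schwarz x y : L x -> L y -> nm (inner H x y) <= nr H x * nr H y.
Proof.
move=> Lx Ly; apply: tends_le (dot_tends Lx Ly); exists 0%N => n _.
apply: le_trans (nm_dot_le _ _ _ _) _.
by rewrite ler_pM ?fnorm_ge0 ?fnorm_le_nr.
Qed.

Lemma nrD x y : L x -> L y -> nr H (x + y) <= nr H x + nr H y.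
Proof.
move=> Lx Ly; apply: nr_le; [exact: carrierD|by rewrite addr_ge0 ?nr_ge0|move=> n].
by apply: le_trans (fnormD _ _ _ _) _; rewrite lerD ?fnorm_le_nr.
Qed.

Lemma nrM x a : L x -> nr H (ract H x a) <= nr H x * nm a.
Proof.
move=> Lx; apply: nr_le; [exact: carrierM|by rewrite mulr_ge0 ?nr_ge0 ?nm_ge0|move=> n].
by apply: le_trans (fnormM _ _ _ _) _; rewrite ler_wpM2r ?nm_ge0 ?fnorm_le_nr.
Qed.

Lemma nrN x : L x -> nr H (- x) = nr H x.
Proof.
move=> Lx; have Nx := carrierN Lx.
by rewrite /nr innerNr// innerNl// opprK.
Qed.

Lemma nrBC x y : L x -> L y -> nr H (x - y) = nr H (y - x).
Proof. by move=> Lx Ly; rewrite -nrN ?opprB//; exact: carrierB. Qed.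

Lemma nr0_eq0 x : L x -> nr H x = 0 -> x = 0.
Proof.
move=> Lx x0; apply/funext => i; apply: nm0_eq0; apply/le_anti.
rewrite nm_ge0 andbT; apply: le_trans (nm_coord_le x (ltnSn i)) _.
by rewrite -x0 fnorm_le_nr.
Qed.

Lemma inner_eq0 x : L x -> inner H x x = 0 -> x = 0.
Proof. by move=> Lx x0; apply: nr0_eq0; rewrite // /nr x0 nm0 sqrtr0. Qed.

Lemma nr_zero : nr H 0 = 0.
Proof.
have -> : (0 : H) = ract H 0 0 by apply/funext => i; rewrite /= mulr0.
apply/le_anti; rewrite nr_ge0 andbT.
by have := nrM 0 carrier0; rewrite nm0 mulr0.
Qed.

Lemma fnorm_lim (u : nat -> H) m n x :
  (forall i, tends (fun j => u j i) (x i)) -> forall e, 0 < e ->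
  exists N, forall j, (N <= j)%N -> fnorm m n (u j - x) < e.
Proof.
move=> ux e e0.
have : tends (fun j => dot m n (u j - x) (u j - x)) (dot m n 0 0).
  apply: (@tends_sum _ _ (fun j i => star ((u j - x) i) * (u j - x) i)) => i.
  have ui : tends (fun j => (u j - x) i) 0.
    by rewrite -(subrr (x i)); apply: tendsB (ux i) (tends_cst _).
  exact: tendsM (tends_star ui) ui.
move=> /(_ (e ^+ 2)) [|N hN]; first by rewrite exprn_gt0.
exists N => j /hN; have -> : dot m n 0 0 = 0 :> A.
  by rewrite /dot big1// => i _; rewrite mulr0.
rewrite subr0 -fnorm_sqr ltr_pXn2r// ?nnegrE ?fnorm_ge0// ltW//.
Qed.

(** On each finite section the Cauchy estimate passes to the coordinatewise limit, uniformly in the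
    section. The limit has small tails because it is close to some [u N]. *)
Lemma l2_complete (u : nat -> H) : (forall n, L (u n)) ->
  (forall e, 0 < e -> exists N, forall m n, (N <= m)%N -> (N <= n)%N ->
     nr H (u m - u n) < e) ->
  exists2 x : H, L x & forall e, 0 < e -> exists N, forall n, (N <= n)%N ->
     nr H (u n - x) < e.
Proof.
move=> Lu uC.
have /choice [x ux] : forall i, exists l, tends (fun j => u j i) l.
  move=> i; apply: nm_complete => e /uC [N hN]; exists N => m n Nm Nn.
  apply: le_lt_trans (hN _ _ Nm Nn).
  apply: le_trans (nm_coord_le (u m - u n) (ltnSn i)) _.
  by apply: fnorm_le_nr; exact: carrierB.
have close e : 0 < e -> exists N, forall n, (N <= n)%N ->
    forall k, fnorm 0 k (u n - x) <= e.
  move=> e0; have [N hN] := uC _ e0; exists N => n Nn k.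
  apply/ler_addgt0Pr => d d0; have [M hM] := fnorm_lim 0 k ux d0.
  have := hM _ (leq_maxr N M); set j := maxn N M.
  have := hN _ _ Nn (leq_maxl N M); rewrite -/j => h1 h2.
  have := fnorm_le_nr k (carrierB (Lu n) (Lu j)).
  have := fnormD 0 k (u n - u j) (u j - x).
  have -> : (u n - u j) \+ (u j - x) = u n - x.
    by apply/funext => i /=; rewrite addrA subrK.
  by lra.
have tail m k (y : H) : fnorm m k y <= fnorm 0 k y.
  have [km|/ltnW mk] := leqP k m; first by rewrite fnorm_geq ?fnorm_ge0.
  apply: ler_wsqrtr; rewrite (dot_split _ _ mk) addrC.
  by apply: pos_nm_le; exact: pos_dot.
have Lx : L x.
  apply/carrier_fnormP => e e0.
  have [N hN] := close (e / 2) ltac:(lra).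
  have /carrier_fnormP /(_ (e / 2) ltac:(lra)) [M hM] := Lu N.
  exists M => m n /(hM _ n) h.
  have := le_trans (tail m n _) (hN _ (leqnn N) n).
  have := fnormD m n (u N) (fun i => - (u N - x) i); rewrite fnormN.
  have -> : u N \+ (fun i => - (u N - x) i) = x.
    by apply/funext => i /=; rewrite opprB addrC subrK.
  by lra.
exists x => // e e0; have [N hN] := close (e / 2) ltac:(lra).
exists N => n /hN h; apply: le_lt_trans (_ : e / 2 < e); last by lra.
by apply: nr_le; [exact: carrierB|lra|exact: h].
Qed.

End L2.

(** * Adjointable operators with closed range *)

Section Contraction.
Context {R : realType} {A : cstarAlgType R}.
Local Notation H := (l2 A).
Local Notation L := (carrier H).
Implicit Types (x y z : H) (a : A) (r s : R).

(** Real multiples go through the action of [A], so every [A]-linear map commutes with them. *)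
Definition rscale r x : H := ract H x (sc r).

Lemma rscaleE r x i : rscale r x i = r%:C *: x i.
Proof. exact: Msc. Qed.

Lemma rscale0 x : rscale 0 x = 0.
Proof. by apply/funext => i; rewrite rscaleE scale0r. Qed.

Lemma rscale_comp r s x : rscale r (rscale s x) = rscale (r * s) x.
Proof. by apply/funext => i; rewrite !rscaleE scalerrA. Qed.

Lemma rscale1 x : rscale 1 x = x.
Proof. by apply/funext => i; rewrite rscaleE scale1r. Qed.

Lemma rscaleDr r s x : rscale (r + s) x = rscale r x + rscale s x.
Proof.
apply/funext => i; rewrite rscaleE rmorphD scalerDl.
by rewrite -[RHS]/(rscale r x i + rscale s x i) !rscaleE.
Qed.

Lemma rscaleB r x y : rscale r (x - y) = rscale r x - rscale r y.
Proof.
apply/funext => i; rewrite rscaleE -[RHS]/(rscale r x i - rscale r y i).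
by rewrite !rscaleE -scalerBr.
Qed.

Lemma ract0 a : ract H 0 a = 0.
Proof. by apply/funext => i; exact: mul0r. Qed.

Lemma carrier_rscale r x : L x -> L (rscale r x).
Proof. exact: carrierM. Qed.

Lemma inner_rscaler r x y : L x -> L y ->
  inner H x (rscale r y) = r%:C *: inner H x y.
Proof. by move=> Lx Ly; rewrite innerMr// Msc. Qed.

Lemma inner_rscalel r x y : L x -> L y ->
  inner H (rscale r x) y = r%:C *: inner H x y.
Proof. by move=> Lx Ly; rewrite innerMl// star_sc scM. Qed.

Lemma nr_rscale r x : L x -> nr H (rscale r x) = `|r| * nr H x.
Proof.
move=> Lx; have Lr := @carrier_rscale r x Lx.
rewrite /nr inner_rscaler// inner_rscalel// scalerrA nmZ sqrtrM ?normr_ge0//.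
by rewrite normrM -expr2 sqrtr_sqr normr_id.
Qed.

Lemma nr_dist_trans x y z : L x -> L y -> L z ->
  nr H (x - z) <= nr H (x - y) + nr H (y - z).
Proof.
move=> Lx Ly Lz; have -> : x - z = (x - y) + (y - z) by rewrite addrA subrK.
by apply: nrD; exact: carrierB.
Qed.

Lemma geometric_limit (E : set H) (u : nat -> H) (C q : R) :
  E `<=` L -> hclosed E -> (forall n, E (u n)) -> 0 <= C -> 0 <= q < 1 ->
  (forall n, nr H (u n.+1 - u n) <= C * q ^+ n) ->
  exists2 x, E x & forall n, nr H (x - u n) <= C * q ^+ n / (1 - q).
Proof.
move=> EL /hclosedP cE Eu C0 /andP[q0 q1] hu.
have Lu n : L (u n) by apply: EL.
have q1' : 0 < 1 - q by rewrite subr_gt0.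
have bnd n k : nr H (u (k + n)%N - u n) <= C * q ^+ n / (1 - q).
  (* Keeping the exact geometric sum lets the induction on [k] close. *)
  suff h : nr H (u (k + n)%N - u n) <= (C * q ^+ n - C * q ^+ (k + n)) / (1 - q).
    apply: le_trans h _; rewrite ler_pM2r ?invr_gt0// gerBl.
    by rewrite mulr_ge0// exprn_ge0.
  elim: k => [|k IH]; first by rewrite add0n !subrr nr_zero mul0r.
  apply: le_trans (@nr_dist_trans _ (u (k + n)%N) _ _ _ _) _ => //.
  apply: le_trans (lerD (hu _) IH) _.
  rewrite addSn exprS le_eqVlt; apply/orP; left; apply/eqP; field.
  by rewrite gt_eqF.
have small e : 0 < e -> exists N, forall n, (N <= n)%N -> C * q ^+ n / (1 - q) < e.
  move=> e0; have e1 : 0 < e * (1 - q) / (C + 1).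
    by rewrite divr_gt0 ?mulr_gt0//; lra.
  have /cvgrPdist_lt /(_ _ e1) [N _ hN] : (fun n => q ^+ n) @ \oo --> (0 : R).
    by apply: cvg_expr; rewrite ger0_norm.
  exists N => n /hN; rewrite /= sub0r normrN ger0_norm ?exprn_ge0//.
  rewrite ltr_pdivlMr ?ltr_pdivrMr//; last by lra.
  apply: le_lt_trans; rewrite mulrC ler_wpM2l ?exprn_ge0//; lra.
have [|x Lx hx] := l2_complete Lu.
  move=> e e0; have [N hN] := small (e / 2) ltac:(lra).
  exists N => m n Nm Nn; apply: le_lt_trans (nr_dist_trans (Lu m) (Lu N) (Lu n)) _.
  rewrite (nrBC (Lu N) (Lu n)).
  have := bnd N (m - N)%N; have := bnd N (n - N)%N; rewrite !subnK//.
  by have := hN N (leqnn N); lra.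
exists x.
  apply: cE => // e /hx [N hN]; exists (u N) => //.
  by rewrite nrBC// hN.
move=> n; apply/ler_addgt0Pr => e /hx [N hN].
have := hN _ (leq_addr n N); have := bnd n N.
have := @nr_dist_trans x (u (N + n)%N) (u n) Lx (Lu _) (Lu _).
by rewrite (nrBC Lx (Lu (N + n)%N)); lra.
Qed.

Lemma le0_of_geometric r C q : 0 <= q < 1 -> (forall n, r <= C * q ^+ n) -> r <= 0.
Proof.
move=> /andP[q0 q1] h; rewrite leNgt; apply/negP => r0.
have C0 : 0 < C by have := h 0%N; rewrite expr0 mulr1; lra.
have /cvgrPdist_lt /(_ (r / C)) : (fun n => q ^+ n) @ \oo --> (0 : R).
  by apply: cvg_expr; rewrite ger0_norm.
rewrite divr_gt0// => /(_ isT) [N _ /(_ N (leqnn N))] /=.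
rewrite sub0r normrN ger0_norm ?exprn_ge0// ltr_pdivlMr// mulrC.
by have := h N; lra.
Qed.

Lemma contraction_fixpoint (E : set H) (f : H -> H) :
  E `<=` L -> hclosed E -> E 0 -> (forall x, E x -> E (f x)) ->
  (forall x y, E x -> E y -> nr H (f x - f y) <= 2^-1 * nr H (x - y)) ->
  exists2 x, E x & f x = x.
Proof.
move=> EL cE E0 Ef fc; pose u n := iter n f 0.
have Eu n : E (u n) by elim: n => //= n; exact: Ef.
have h12 : 0 <= (2^-1 : R) < 1 by lra.
have [||n|x Ex hx] := @geometric_limit E u (nr H (u 1%N - u 0%N)) 2^-1 EL cE Eu.
- exact: nr_ge0.
- by [].
- elim: n => [|n IH]; first by rewrite expr0 mulr1.
  rewrite exprS mulrCA; apply: le_trans (fc _ _ (Eu n.+1) (Eu n)) _.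
  by rewrite ler_wpM2l.
exists x => //; apply/eqP; rewrite -subr_eq0; apply/eqP.
have Lx := EL _ Ex; have Lfx := EL _ (Ef _ Ex).
apply: nr0_eq0; first exact: carrierB.
apply/le_anti; rewrite nr_ge0 andbT.
(* With [c = |u 1 - u 0|] and [q = 1/2], the distance from [x] to [u n] is at most [2 c q^n], so
   [|f x - f (u n)|] and [|u n.+1 - x|] are each at most [c q^n]. *)
apply: (@le0_of_geometric _ (nr H (u 1%N - u 0%N) * 2) 2^-1 h12) => n.
have Lu := EL _ (Eu n.+1).
have := nr_dist_trans Lfx Lu Lx; rewrite (nrBC Lu Lx).
have := hx n; have := hx n.+1; have := fc _ _ Ex (Eu n).
rewrite exprS; have -> : (1 - 2^-1 : R) = 2^-1 by lra.
rewrite invrK; have := nr_ge0 (u 1%N - u 0%N); set c := nr _ _.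
move: (2^-1 ^+ n) => p; set v := nr _ (f x - _).
by rewrite /u /= -/(u n); lra.
Qed.

(* The method of continuity along [s + l], [l >= 0], which stays bounded below by
   [d] and is a small perturbation of [l] when [l] is large. *)
Lemma surj_of_bounded_below (E : set H) (s : H -> H) (B d : R) :
  closed_submodule E -> 0 <= B -> 0 < d ->
  (forall x, E x -> E (s x)) ->
  (forall x y, E x -> E y -> s (x - y) = s x - s y) ->
  (forall x, E x -> nr H (s x) <= B * nr H x) ->
  (forall x l, E x -> 0 <= l -> d * nr H x <= nr H (s x + rscale l x)) ->
  forall y, E y -> exists2 x, E x & s x = y.
Proof.
move=> [EL E0 ED EM cE] B0 d0 Es sB sb slow.
have EZ r x : E x -> E (rscale r x) by exact: EM.
have EN x : E x -> E (- x) by rewrite -ractN1; exact: EM.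
have EB x y : E x -> E y -> E (x - y) by move=> Ex Ey; apply: ED => //; exact: EN.
pose surj l := forall y, E y -> exists2 x, E x & s x + rscale l x = y.
(* The solution is a fixed point of [x |-> l^-1 (y - s x)], which has Lipschitz constant [B / l]. *)
have start l : 0 < l -> 2 * B <= l -> surj l.
  move=> l0 lB y Ey; pose f x := rscale l^-1 (y - s x).
  have li : 0 < l^-1 by rewrite invr_gt0.
  have [|x1 x2 E1 E2|x Ex fx] := @contraction_fixpoint E f EL cE E0.
  - by move=> x Ex; apply/EZ/EB => //; exact: Es.
  - rewrite /f -rscaleB opprB addrC addrA subrK -sB// nr_rscale; last exact/EL/Es/EB.
    rewrite gtr0_norm// (nrBC (EL _ E1) (EL _ E2)).
    apply: le_trans (_ : l^-1 * (B * nr H (x2 - x1)) <= _).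
      by rewrite ler_pM2l// sb//; exact: EB.
    rewrite mulrA ler_wpM2r ?nr_ge0// mulrC ler_pdivrMr//; lra.
  exists x => //; rewrite -{2}fx /f rscale_comp divff ?gt_eqF// rscale1.
  by rewrite addrC subrK.
(* Let [f x] solve [(s + l + d/2) w = y + (d/2) x] for [w]. The lower bound [d] makes [f] contract
   by [1/2], and its fixed point solves [(s + l) x = y]. *)
have step l : 0 <= l -> surj (l + d / 2) -> surj l.
  move=> l0 sl y Ey.
  have /choice [f hf] : forall x, exists w,
      E x -> E w /\ s w + rscale (l + d / 2) w = y + rscale (d / 2) x.
    move=> x; have [Ex|nEx] := pselect (E x); last by exists x.
    have [|w Ew ww] := sl (y + rscale (d / 2) x); first by apply: ED => //; exact: EZ.
    by exists w.
  have [x Ex|x1 x2 E1 E2|x Ex fx] := @contraction_fixpoint E f EL cE E0.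
  - by have [] := hf x Ex.
  - have [F1 e1] := hf _ E1; have [F2 e2] := hf _ E2.
    have := slow (f x1 - f x2) (l + d / 2) (EB _ _ F1 F2) ltac:(lra).
    rewrite sB// rscaleB addrACA -opprD e1 e2 opprD addrACA subrr add0r -rscaleB.
    rewrite nr_rscale; last exact/EL/EB.
    rewrite ger0_norm; last by lra.
    by rewrite -mulrA ler_pM2l.
  have [_] := hf x Ex; rewrite fx rscaleDr addrA => /addIr e.
  by exists x.
(* The step [d / 2] is the same for all [l], so finitely many steps lead from a large [l] down to
   [0]. *)
have chain n : surj (n%:R * (d / 2)) -> surj 0.
  elim: n => [|n IH]; first by rewrite mul0r.
  rewrite -natr1 mulrDl mul1r => /step h; apply/IH/h.
  by rewrite mulr_ge0//; lra.
have h0 : 0 <= (2 * B + 1) / (d / 2) by rewrite divr_ge0//; lra.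
have := archi_boundP h0; set n := Num.bound _; rewrite ltr_pdivrMr; last by lra.
move=> hn y /(chain n _) [|x Ex]; first by apply: start; lra.
by rewrite rscale0 addr0; exists x.
Qed.

End Contraction.

(** * Adjoint pairs, orthogonal decompositions and kernels of composites *)

Section AdjointPair.
Context {R : realType} {A : cstarAlgType R}.
Local Notation H := (l2 A).
Local Notation L := (carrier H).
Implicit Types (x y z : H) (a : A) (r s : R) (F G D : H -> H).

(** Names the adjoint explicitly. Linearity of both maps and the bound on [G] are derived from the
    adjoint relation and the bound on [F], so the notion is symmetric. *)
Definition adjoint_pair F G : Prop :=
  [/\ forall x, L x -> L (F x), forall x, L x -> L (G x), hbounded F &
      forall x y, L x -> L y -> inner H (F x) y = inner H x (G y)].

Lemma inner_ext x y : L x -> L y ->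
  (forall z, L z -> inner H x z = inner H y z) -> x = y.
Proof.
move=> Lx Ly h; apply/eqP; rewrite -subr_eq0; apply/eqP.
have Lxy := carrierB Lx Ly.
by apply: inner_eq0 => //; rewrite innerBl// h// subrr.
Qed.

(** [|G x|^2 = |<F (G x), x>| <= C |G x| |x|], and [|G x|] cancels. *)
Lemma adjoint_pair_sym F G : adjoint_pair F G -> adjoint_pair G F.
Proof.
move=> [LF LG /hboundedP [C C0 hC] FG]; split => //; last first.
  move=> x y Lx Ly; have LGx := LG _ Lx; have LFy := LF _ Ly.
  by rewrite -inner_star// -FG// inner_star.
apply/hboundedP; exists C => // x Lx.
have LGx := LG _ Lx; have LFGx := LF _ LGx.
have h : nr H (G x) ^+ 2 <= C * nr H (G x) * nr H x.
  rewrite nr_sqr -FG//; apply: le_trans (cauchy_schwarz LFGx Lx) _.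
  by rewrite ler_wpM2r ?nr_ge0// hC.
have := nr_ge0 (G x); rewrite le_eqVlt => /orP[/eqP <-|g0].
  by rewrite mulr_ge0// nr_ge0.
by rewrite -(ler_pM2r g0) -expr2 mulrAC.
Qed.

Lemma adjoint_pairD F G x y : adjoint_pair F G -> L x -> L y ->
  F (x + y) = F x + F y.
Proof.
move=> [LF LG _ FG] Lx Ly; have [LFx LFy] := (LF _ Lx, LF _ Ly).
have Lxy := carrierD Lx Ly; have Fxy := LF _ Lxy.
apply: inner_ext => //; first exact: carrierD.
move=> z Lz; have LGz := LG _ Lz.
by rewrite FG// !innerDl// !FG.
Qed.

Lemma adjoint_pairM F G x a : adjoint_pair F G -> L x ->
  F (ract H x a) = ract H (F x) a.
Proof.
move=> [LF LG _ FG] Lx; have LFx := LF _ Lx.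
have Lxa := @carrierM _ _ x a Lx; have Fxa := LF _ Lxa.
apply: inner_ext => //; first exact: carrierM.
move=> z Lz; have LGz := LG _ Lz.
by rewrite FG// !innerMl// FG.
Qed.

Lemma adjoint_pairB F G x y : adjoint_pair F G -> L x -> L y ->
  F (x - y) = F x - F y.
Proof.
move=> FG Lx Ly; rewrite (adjoint_pairD FG)//; last exact: carrierN.
by rewrite -!ractN1 (adjoint_pairM _ FG).
Qed.

Lemma adjoint_pair0 F G : adjoint_pair F G -> F 0 = 0.
Proof.
move=> FG; rewrite -(subrr 0) (adjoint_pairB FG) ?subrr//; exact: carrier0.
Qed.

Lemma im_submodule F G : adjoint_pair F G -> hclosed (im F) ->
  closed_submodule (im F).
Proof.
move=> FG cF; have [LF _ _ _] := FG; split=> //.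
- by move=> _ [x Lx <-]; exact: LF.
- by exists 0; [exact: carrier0|exact: adjoint_pair0 FG].
- move=> _ _ [x Lx <-] [y Ly <-]; exists (x + y); first exact: carrierD.
  by rewrite (adjoint_pairD FG).
- move=> _ a [x Lx <-]; exists (ract H x a); first exact: carrierM.
  by rewrite (adjoint_pairM _ FG).
Qed.

(* A gliding hump: were the bound to fail, a signed series of unit vectors
   [z n] of the range, with weights [3^-n], would converge to some [F x] with
   [<z n, F x> = <G (z n), x>] of norm at least [3^-n / 2]. *)
Lemma adjoint_bounded_below F G : adjoint_pair F G -> hclosed (im F) ->
  exists2 c, 0 < c & forall z, im F z -> nr H z <= c * nr H (G z).
Proof.
move=> FG cF; have [EL E0 ED EM _] := im_submodule FG cF.
have GF := adjoint_pair_sym FG.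
have [LF LG _ FGE] := FG.
apply: contrapT => nc.
pose w n : R := 3^-1 ^+ n.
have w0 n : 0 < w n by rewrite exprn_gt0.
have /choice [z hz] : forall n : nat, exists z,
    [/\ im F z, nr H z = 1 & nr H (G z) * n.+1%:R <= w n].
  move=> n; apply: contrapT => hn; apply: nc.
  have c0 : 0 < n.+1%:R / w n by rewrite divr_gt0.
  exists (n.+1%:R / w n) => // z Ez; rewrite leNgt; apply/negP => h.
  have Lz := EL _ Ez; have LGz := LG _ Lz.
  have z0 : 0 < nr H z.
    by apply: le_lt_trans h; rewrite mulr_ge0 ?nr_ge0// ltW.
  have zi : 0 < (nr H z)^-1 by rewrite invr_gt0.
  apply: hn; exists (rscale (nr H z)^-1 z); split.
  - exact: EM.
  - by rewrite nr_rscale// gtr0_norm// mulVf// gt_eqF.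
  - rewrite (adjoint_pairM _ GF)// -/(rscale _ _) nr_rscale// gtr0_norm//.
    rewrite -mulrA mulrC ler_pdivrMr// mulrC.
    move: h; rewrite mulrAC ltr_pdivrMr// => /ltW.
    by rewrite [w n * _]mulrC.
have Lz n : L (z n) by have [/EL] := hz n.
pose v n := rscale (w n) (z n).
have Lv n : L (v n) by exact: carrier_rscale.
have Ev n : im F (v n) by have [Ez _ _] := hz n; exact: EM.
have EN x : im F x -> im F (- x) by rewrite -ractN1; exact: EM.
(* The sign is chosen to ensure [|<z m, y m.+1>| >= w m]: the two candidates for this inner product
   differ by an element of norm [2 * w m]. *)
pose fix y n : H := if n is m.+1 then
  (if w m <= nm (inner H (z m) (y m + v m)) then y m + v m else y m - v m) else 0.
have Ey n : im F (y n).
  by elim: n => //= n IH; case: ifP => _; apply: ED => //; exact: EN.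
have Ly n : L (y n) by apply: EL.
have ystep n : nr H (y n.+1 - y n) <= 1 * 3^-1 ^+ n.
  have vn : nr H (v n) = w n.
    by have [_ z1 _] := hz n; rewrite nr_rscale// z1 mulr1 gtr0_norm.
  rewrite mul1r -/(w n) -vn /=; case: ifP => _; rewrite addrAC subrr add0r//.
  by rewrite nrN.
have yz n : w n <= nm (inner H (z n) (y n.+1)).
  rewrite -[y n.+1]/(if w n <= nm (inner H (z n) (y n + v n)) then y n + v n
    else y n - v n).
  case: ifP => // /negbT; rewrite -ltNge => h.
  have zv : nm (inner H (z n) (v n)) = w n.
    have [_ z1 _] := hz n.
    by rewrite inner_rscaler// nmZ gtr0_norm// -nr_sqr z1 expr1n mulr1.
  have := nmB (inner H (z n) (y n + v n)) (inner H (z n) (y n - v n)).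
  rewrite innerDr// innerBr// in h *.
  rewrite opprB addrC addrA subrK.
  set p := inner H (z n) (v n) in h zv *.
  have -> : nm (p + p) = 2 * nm p.
    have := nmZ 2 p; rewrite ger0_norm// => <-; congr nm.
    by rewrite -[2%:C]/((1 + 1 : R)%:C) rmorphD scalerDl !scale1r.
  by rewrite zv; lra.
have h13 : 0 <= (3^-1 : R) < 1 by lra.
have [_ [x Lx <-] hx] := geometric_limit EL cF Ey (ler01 : 0 <= 1 :> R) h13 ystep.
(* Comparing [w n / 2 <= |<G (z n), x>|] with [|G (z n)| <= w n / n.+1] bounds every [n] by a fixed
   real. *)
have lower n : n.+1%:R <= 2 * nr H x.
  have [_ z1 Gz] := hz n; have LGz := LG _ (Lz n); have LFx := LF _ Lx.
  have h1 : nm (inner H (z n) (F x)) <= nr H (G (z n)) * nr H x.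
    by have [_ _ _ GFE] := GF; rewrite -GFE// cauchy_schwarz.
  (* The later terms contribute at most [w n.+1 / (1 - 3^-1) = w n / 2], half of what [yz]
     guarantees. *)
  have h2 : nm (inner H (z n) (F x - y n.+1)) <= w n / 2.
    have LFy := carrierB LFx (Ly n.+1).
    apply: le_trans (cauchy_schwarz (Lz n) LFy) _; rewrite z1 mul1r.
    apply: le_trans (hx _) _; rewrite exprS -/(w n).
    have -> : (1 - 3^-1 : R)^-1 = 3 / 2 by field.
    by have := w0 n; lra.
  rewrite innerBr// in h2.
  have h3 := nmB (inner H (z n) (F x)) (inner H (z n) (F x) - inner H (z n) (y n.+1)).
  rewrite opprB addrC subrK in h3.
  have h4 : w n / 2 <= nr H (G (z n)) * nr H x by have := yz n; lra.
  have n0 : 0 < n.+1%:R :> R by [].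
  have h5 : w n / 2 * n.+1%:R <= w n * nr H x.
    apply: le_trans (_ : nr H (G (z n)) * nr H x * n.+1%:R <= _).
      by rewrite ler_pM2r.
    by rewrite mulrAC ler_wpM2r ?nr_ge0.
  have := w0 n; rewrite -(ler_pM2l (w0 n)); lra.
have x0 : 0 <= 2 * nr H x by rewrite mulr_ge0// nr_ge0.
have := archi_boundP x0; have := lower (Num.bound (2 * nr H x)).
by rewrite -natr1; lra.
Qed.

(** The lower bound [d = c^-2] comes from [|z|^2 <= c^2 |G z|^2 <= c^2 |F (G z)| |z|]. *)
Lemma im_comp_adjoint F G : adjoint_pair F G -> hclosed (im F) ->
  forall y, im F y -> exists2 x, im F x & F (G x) = y.
Proof.
move=> FG cF; have sE := im_submodule FG cF.
have [EL _ _ _ _] := sE.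
have GF := adjoint_pair_sym FG.
have [LF LG /hboundedP [C C0 hC] FGE] := FG.
have [_ _ /hboundedP [K K0 hK] GFE] := GF.
have [c c0 hc] := adjoint_bounded_below FG cF.
apply: (@surj_of_bounded_below _ _ (im F) (F \o G) (C * K) (c ^+ 2)^-1) => //.
- exact: mulr_ge0.
- by rewrite invr_gt0 exprn_gt0.
- by move=> x /EL /LG LGx; exists (G x).
- move=> x y /EL Lx /EL Ly /=.
  by rewrite (adjoint_pairB GF)// (adjoint_pairB FG)//; exact: LG.
- move=> x /EL Lx; apply: le_trans (hC _ (LG _ Lx)) _.
  by rewrite -mulrA ler_wpM2l// hK.
move=> x l Ex l0; have Lx := EL _ Ex; have LGx := LG _ Lx; have LFGx := LF _ LGx.
have Llx : L (rscale l x) by exact: carrier_rscale.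
apply: (@le_trans _ _ (nr H (F (G x)))).
  rewrite mulrC ler_pdivrMr ?exprn_gt0//.
  have := nr_ge0 x; rewrite le_eqVlt => /orP[/eqP <-|x0].
    by rewrite mulr_ge0 ?nr_ge0 ?sqr_ge0.
  have h1 : nr H (G x) ^+ 2 <= nr H (F (G x)) * nr H x.
    by rewrite nr_sqr -FGE//; exact: cauchy_schwarz.
  have h2 : nr H x ^+ 2 <= c ^+ 2 * nr H (G x) ^+ 2.
    by rewrite -exprMn lerXn2r ?nnegrE ?mulr_ge0 ?nr_ge0 ?(ltW c0)// hc.
  rewrite -(ler_pM2r x0) -expr2; apply: le_trans h2 _.
  by rewrite mulrC [leRHS]mulrAC ler_wpM2r ?sqr_ge0.
(* For [s = F \o G], the square of [s x + l x] expands to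
   [<s x, s x> + 2 l <G x, G x> + l^2 <x, x>], a sum of positive elements. *)
apply: ler_wsqrtr.
have LL := carrierD LFGx Llx.
rewrite -[(F \o G) x]/(F (G x)) innerDr// !innerDl// -addrA.
apply: pos_nm_le; first exact: inner_pos.
rewrite !inner_rscalel// !inner_rscaler// FGE// -GFE//.
have pG := posZ l0 (inner_pos LGx).
by do 2?[apply: posD => //]; do 2![apply: posZ => //]; exact: inner_pos.
Qed.

(** This says [l2 A = ker F + im G]; for an adjoint pair the sum is orthogonal by
    [ker_im_orthogonal]. *)
Definition complemented F G := forall x, L x -> exists2 y, L y & F (x - G y) = 0.

Lemma complemented_ker F G : adjoint_pair F G -> hclosed (im F) -> complemented F G.
Proof.
move=> FG cF x Lx; have [LF LG _ _] := FG.
have [|w [y Ly <-] e] := im_comp_adjoint FG cF (_ : im F (F x)); first by exists x.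
have LFy := LF _ Ly; exists (F y) => //.
by rewrite (adjoint_pairB FG) ?e ?subrr//; exact: LG.
Qed.

Lemma inner0l x : L x -> inner H 0 x = 0.
Proof.
move=> Lx; rewrite -(rscale0 0) inner_rscalel ?scale0r//; exact: carrier0.
Qed.

(** Solve [F (G (F y)) = F (G x)]. Then [v = x - F y] has [F (G v) = 0], so
    [<G v, G v> = <F (G v), v> = 0]. *)
Lemma complemented_im F G : adjoint_pair F G -> hclosed (im F) -> complemented G F.
Proof.
move=> FG cF x Lx; have GF := adjoint_pair_sym FG; have [LF LG _ FGE] := FG.
have [|w [y Ly <-] e] := im_comp_adjoint FG cF (_ : im F (F (G x))).
  by exists (G x) => //; exact: LG.
have LFy := LF _ Ly; exists y => //.
have Lxy := carrierB Lx LFy; have LGxy := LG _ Lxy.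
have FG0 : F (G (x - F y)) = 0.
  have [LGx LGFy] := (LG _ Lx, LG _ LFy).
  by rewrite (adjoint_pairB GF)// (adjoint_pairB FG)// e subrr.
by apply: inner_eq0 => //; rewrite -FGE// FG0 inner0l.
Qed.

Lemma ker_im_orthogonal F G u y : adjoint_pair F G -> L u -> L y -> F u = 0 ->
  inner H u (G y) = 0.
Proof. by move=> [_ _ _ FG] Lu Ly Fu; rewrite -FG// Fu inner0l. Qed.

(** If [x] is in the closure of [im G], its component [u] in [ker F] satisfies
    [<u, u> = <u, x - G z>] for all [z], and [x - G z] can be made arbitrarily small. *)
Lemma complemented_im_closed F G : adjoint_pair F G -> complemented F G ->
  hclosed (im G).
Proof.
move=> FG cFG; have [LF LG _ _] := FG.
apply/hclosedP => x Lx hx; have [y Ly uy] := cFG x Lx; exists y => //.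
have LGy := LG _ Ly; set u := x - G y in uy.
have Lu : L u by exact: carrierB.
suff u0 : nr H u = 0 by apply/esym/eqP; rewrite -subr_eq0; apply/eqP/nr0_eq0.
have h e : 0 < e -> nr H u ^+ 2 <= nr H u * e.
  move=> /hx [_ [z Lz <-] hz]; have LGz := LG _ Lz; rewrite nr_sqr.
  have -> : inner H u u = inner H u (x - G z).
    by rewrite {2}/u !innerBr// !(ker_im_orthogonal FG Lu).
  apply: le_trans (cauchy_schwarz Lu (carrierB Lx LGz)) _.
  by rewrite ler_wpM2l ?nr_ge0// ltW.
apply/eqP; apply: contraT => u0.
have up : 0 < nr H u by rewrite lt_neqAle eq_sym u0 nr_ge0.
have := h (nr H u / 2) ltac:(lra); nra.
Qed.

(** The second clause characterizes [P x] by the decomposition; the linearity of [P] is read off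
    from it. *)
Lemma ker_projection F G : adjoint_pair F G -> complemented F G ->
  exists P : H -> H, [/\ forall x, L x -> ker F (P x),
    forall x u, L x -> ker F u -> im G (x - u) -> P x = u,
    forall x, L x -> im G (x - P x) &
    forall x, L x -> nr H (P x) <= nr H x].
Proof.
move=> FG cFG; have GF := adjoint_pair_sym FG; have [LF LG _ _] := FG.
have /choice [P hP] : forall x, exists u, L x -> ker F u /\ im G (x - u).
  move=> x; have [Lx|nLx] := pselect (L x); last by exists x.
  have [y Ly e] := cFG x Lx; exists (x - G y) => _; split; last first.
    by exists y; rewrite // opprB addrC subrK.
  by split=> //; apply: carrierB => //; exact: LG.
exists P; split=> [x Lx|x u Lx [Lu Fu] [y Ly yE]|x Lx|x Lx].
- by have [] := hP x Lx.
- have [[LP FP] [z Lz zE]] := hP x Lx.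
  (* The difference lies in both [ker F] and [im G], so it is orthogonal to itself. *)
  have d : P x - u = G (y - z).
    by rewrite (adjoint_pairB GF)// yE zE opprB [RHS]addrC addrA subrK.
  apply/eqP; rewrite -subr_eq0; apply/eqP.
  apply: inner_eq0; first exact: carrierB.
  rewrite {2}d (ker_im_orthogonal FG)//; [exact: carrierB|exact: carrierB|].
  by rewrite (adjoint_pairB FG)// FP Fu subrr.
- by have [] := hP x Lx.
- have [[LP FP] [z Lz zE]] := hP x Lx; have LGz := LG _ Lz.
  have h : nr H (P x) ^+ 2 <= nr H (P x) * nr H x.
    have xE : x = P x + G z by rewrite zE addrC subrK.
    rewrite nr_sqr; have -> : inner H (P x) (P x) = inner H (P x) x.
      have := innerDr LP LP LGz.
      by rewrite -xE (ker_im_orthogonal FG LP Lz FP) addr0 => ->.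
    exact: cauchy_schwarz.
  have := nr_ge0 (P x); rewrite le_eqVlt => /orP[/eqP <-|p0]; first exact: nr_ge0.
  by rewrite -(ler_pM2l p0).
Qed.

Lemma ker_comp_preceq F G D D' : adjoint_pair F G -> adjoint_pair D D' ->
  complemented F G -> hclosed (im F) ->
  submod (ker (D \o F)) ⪯ submod (ker D) ⊕ submod (ker F).
Proof.
move=> FG DD cFG cF; have GF := adjoint_pair_sym FG.
have [LF LG /hboundedP [C C0 hC] _] := FG; have [LD _ _ _] := DD.
have [P [kP uP iP bP]] := ker_projection FG cFG.
pose M := submod (ker (D \o F)); pose N := submod (ker D) ⊕ submod (ker F).
pose T : M -> N := fun x => (F x, P x).
pose S : set N := [set p | [/\ ker D p.1, im F p.1 & ker F p.2]].
have kFD u v : ker F u -> ker F v -> ker F (u + v).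
  move=> [Lu Fu] [Lv Fv]; split; first exact: carrierD.
  by rewrite (adjoint_pairD FG)// Fu Fv addr0.
have kFM u a : ker F u -> ker F (ract H u a).
  move=> [Lu Fu]; split; first exact: carrierM.
  by rewrite (adjoint_pairM _ FG)// Fu ract0.
have rangeT x : L x -> D (F x) = 0 -> S (T x).
  by move=> Lx DFx; split; [split=> //; exact: LF|exists x|exact: kP].
exists T, S; split.
- split.
  + by move=> p [kD _ kF]; split.
  + by split=> /=; [split|exists 0|split];
      rewrite ?(adjoint_pair0 FG) ?(adjoint_pair0 DD)//; exact: carrier0.
  + move=> p q [[Lp Dp] [x Lx xE] kp] [[Lq Dq] [y Ly yE] kq]; split=> /=.
    * by split; [exact: carrierD|rewrite (adjoint_pairD DD)// Dp Dq addr0].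
    * by exists (x + y); [exact: carrierD|rewrite (adjoint_pairD FG)// xE yE].
    * exact: kFD.
  + move=> p a [[Lp Dp] [x Lx xE] kp]; split=> /=.
    * split; first exact: carrierM.
      by rewrite (adjoint_pairM _ DD)// Dp ract0.
    * by exists (ract H x a); [exact: carrierM|rewrite (adjoint_pairM _ FG)// xE].
    * exact: kFM.
  + apply/hclosedP => p [k1 k2] hp; split=> //.
    move/hclosedP : cF; apply; first by case: k1.
    move=> e /hp [q [kq1 iq kq2] pq]; exists q.1 => //.
    (* The norm of a pair dominates that of its first entry, so approximation in the sum gives
       approximation in [im F]. *)
    apply: le_lt_trans pq; apply: ler_wsqrtr.
    by apply: pos_nm_le; apply: inner_pos; apply: carrierB;
      [case: k1|case: kq1|case: k2|case: kq2].
- split.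
  + move=> x y [Lx _] [Ly _]; rewrite /T (adjoint_pairD FG)//; congr (_, _).
    apply: uP; [exact: carrierD|by apply: kFD; exact: kP|].
    have [[u Lu uE] [v Lv vE]] := (iP x Lx, iP y Ly).
    exists (u + v); first exact: carrierD.
    by rewrite (adjoint_pairD GF)// uE vE addrACA -opprD.
  + move=> x a [Lx _]; rewrite /T /= (adjoint_pairM _ FG)//; congr (_, _).
    apply: uP; [exact: carrierM|by apply: kFM; exact: kP|].
    have [u Lu uE] := iP x Lx; exists (ract H u a); first exact: carrierM.
    rewrite (adjoint_pairM _ GF)// uE; apply/funext => i /=; exact: mulrBl.
- apply/hboundedP; exists (C + 1); first by lra.
  move=> x [Lx _]; have [LFx [LPx _]] := (LF _ Lx, kP _ Lx).
  have X0 := nr_ge0 x.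
  rewrite -(@ler_pXn2r _ 2) ?nnegrE ?nr_ge0 ?mulr_ge0//; last by lra.
  rewrite nr_sqr; apply: le_trans (nmD _ _) _.
  rewrite -[nm _]/(nm (inner H (F x) (F x))).
  rewrite -[nm (inner _ (T x).2 _)]/(nm (inner H (P x) (P x))).
  rewrite -!nr_sqr.
  have h1 : nr H (F x) ^+ 2 <= (C * nr H x) ^+ 2.
    by rewrite lerXn2r ?nnegrE ?nr_ge0 ?mulr_ge0// hC.
  have h2 : nr H (P x) ^+ 2 <= nr H x ^+ 2 by rewrite lerXn2r ?nnegrE ?nr_ge0// bP.
  apply: le_trans (lerD h1 h2) _; rewrite -[nr M x]/(nr H x); nra.
- split.
  + by move=> x [Lx DFx]; exact: rangeT.
  + move=> x y; rewrite !inE => -[Lx _] [Ly _] [Fxy Pxy].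
    have [[u Lu uE] [v Lv vE]] := (iP x Lx, iP y Ly).
    have Lxy := carrierB Lx Ly.
    apply/eqP; rewrite -subr_eq0; apply/eqP; apply: inner_eq0 => //.
    (* As [P x = P y], the difference lies in [im G]; it also lies in [ker F]. *)
    have {2}-> : x - y = G (u - v).
      by rewrite (adjoint_pairB GF)// uE vE Pxy opprB addrA subrK.
    rewrite (ker_im_orthogonal FG)//; first exact: carrierB.
    by rewrite (adjoint_pairB FG)// Fxy subrr.
  + move=> [y1 y2] [[L1 D1] [x Lx xE] [L2 F2]] /=.
    have [LPx FPx] := kP _ Lx; have LxP := carrierB Lx LPx.
    (* Replacing the kernel component [P x] of [x] by [y2] gives the preimage of the pair. *)
    have Fx : F (x - P x + y2) = y1.
      by rewrite (adjoint_pairD FG)// (adjoint_pairB FG)// FPx F2 subr0 addr0 xE.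
    have Lx2 : L (x - P x + y2) by exact: carrierD.
    exists (x - P x + y2); first by split; rewrite //= Fx.
    rewrite /T Fx; congr (_, _); apply: uP => //.
    by rewrite addrK; exact: iP.
Qed.

End AdjointPair.

(** * The relations for complements and for kernels *)

Theorem lemma3p20 (R : realType) (A : cstarAlgType R) (F D : l2 A -> l2 A)
    (hF : bounded_adjointable F) (hD : bounded_adjointable D)
    (imF_closed : hclosed (im F)) (imD_closed : hclosed (im D))
    (imDF_closed : hclosed (im (D \o F))) :
  submod (perp (im (D \o F))) ⪯ submod (perp (im F)) ⊕ submod (perp (im D)) /\
  submod (ker (D \o F)) ⪯ submod (ker D) ⊕ submod (ker F).
Proof.
have [LF _ bF [F' LF' FF']] := hF; have [LD _ bD [D' LD' DD']] := hD.
have pF : adjoint_pair F F' by split.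
have pD : adjoint_pair D D' by split.
(* If [y] is orthogonal to [im B], then [<B' y, B' y> = <B (B' y), y> = 0]. *)
have perpE (B B' : l2 A -> l2 A) : adjoint_pair B B' -> perp (im B) = ker B'.
  move=> [LB LB' _ BE]; apply/seteqP; split=> y [Ly h]; split=> //.
    have LBy := LB' _ Ly; apply: inner_eq0 => //; rewrite -BE//.
    by apply: h; exists (B' y).
  by move=> _ [x Lx <-]; rewrite BE// h -(subrr 0) innerBr ?subrr//; exact: carrier0.
have pDF : adjoint_pair (D \o F) (F' \o D').
  split.
  - by move=> x /LF /LD.
  - by move=> x /LD' /LF'.
  - apply/hboundedP; move/hboundedP: bF => [C C0 hC]; move/hboundedP: bD => [K K0 hK].
    exists (K * C); first exact: mulr_ge0.
    move=> x Lx; apply: le_trans (hK _ (LF _ Lx)) _.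
    by rewrite -mulrA ler_wpM2l// hC.
  - move=> x y Lx Ly; rewrite -[(D \o F) x]/(D (F x)) DD' ?FF'//; first exact: LD'.
    exact: LF.
rewrite !(perpE _ _ pF) (perpE _ _ pD) (perpE _ _ pDF); split.
  (* For [F' \o D'] the inner map is [D']; its range is closed by the decomposition that the closed
     range of [D] provides. *)
  have qD := adjoint_pair_sym pD.
  apply: (ker_comp_preceq qD (adjoint_pair_sym pF)).
    exact: complemented_im.
  by apply: complemented_im_closed pD _; exact: complemented_ker.
exact: ker_comp_preceq pF pD (complemented_ker pF imF_closed) imF_closed.
Qed.
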